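(* Let $X$ be a separable Banach space such that $X^*$ has a weak$^*$ unconditional asymptotic structure, and let $G$ be a non-trivial countably branching bundle graph. Then the following properties are equivalent. (1) The space $X$ admits an equivalent norm whose dual norm is AUC$^*$. (2) The family $(G^{\oslash n})_{n\ge1}$ of countably branching bundle graphs generated by $G$ does not equi-Lipschitz embed into $X^*$.
   Context: Let $\mathrm{cof}_{w^*}(X^* )$ be the set of weak$^*$-closed subspaces of $X^*$ of finite codimension; $S_Y$ denotes the unit sphere of $Y$. Weak$^*$ unconditional asymptotic structure: there is $C\ge1$ such that for every $n\ge1$: $\exists X_1\in\mathrm{cof}_{w^*}(X^* )\ \forall x_1^*\in S_{X_1}\ \cdots\ \exists X_n\in\mathrm{cof}_{w^*}(X^* )\ \forall x_n^*\in S_{X_n}$: $(x_i^* )_{i=1}^n$ is $C$-unconditional, i.e. $\|\sum\epsilon_ia_ix_i^*\|\le C\|\sum a_ix_i^*\|$ for all scalars $a_i$ and signs $\epsilon_i$. AUC$^*$: a norm on $X^*$ is AUC$^*$ if for all $t>0$, $\inf_{x^*\in S_{X^*}}\ \sup_{Y\in\mathrm{cof}_{w^*}(X^* )}\ \inf_{y^*\in S_Y}(\|x^*+ty^*\|-1)>0$ (with $\inf\emptyset=+\infty$). Bundle graphs. A top-bottom graph is a (simple) graph with two distinguished vertices, one designated as the top and the other as the bottom. A countably branching bundle graph is a top-bottom graph that can be formed, starting from a path of length $1$, by a finite sequence of the following operations: (i) given two countably branching bundle graphs, identify the top of one with the bottom of the other, the bottom of the first being the new bottom and the top of the second the new top;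 (ii) take countably infinitely many copies of a countably branching bundle graph and identify all the bottoms with each other and all the tops with each other. It is non-trivial if it is obtained by such a sequence with at least one operation (ii) (applied to a graph other than a single edge). Bundle graphs carry the graph distance. Edges are oriented from bottom to top; $G\oslash H$ is obtained by replacing every edge of $G$ by a copy of $H$ (bottom and top of $H$ placed at the lower and upper endpoint of the edge), and $G^{\oslash1}=G$, $G^{\oslash(n+1)}=G\oslash G^{\oslash n}$. A family $(M_n,d_n)$ equi-Lipschitz embeds into $X^*$ if there are $D\ge1$, maps $f_n:M_n\to X^*$ and $s_n>0$ with $s_nd_n(x,y)\le\|f_n(x)-f_n(y)\|\le s_nD\,d_n(x,y)$ for all $n$ and $x,y\in M_n$. *)

(* Defs.v *)
From HB Require Import structures.
From Stdlib Require Import Relation_Operators.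
From mathcomp Require Import all_boot all_order all_algebra.
From mathcomp Require Import all_classical all_reals all_analysis.

Set Implicit Arguments.
Unset Strict Implicit.
Unset Printing Implicit Defensive.

Import Order.TTheory GRing.Theory Num.Theory.
Import numFieldNormedType.Exports.

Local Open Scope classical_set_scope.
Local Open Scope ring_scope.

Definition separable (T : topologicalType) : Prop :=
  exists A : set T, countable A /\ dense A.

Section Dual.
Context {R : realType} {X : normedModType R}.

Definition continuous_linear : {pred (X -> R^o)} :=
  [pred f | `[< linear f /\ continuous f >]].

Lemma continuous_linear_submod_closed : submod_closed continuous_linear.
Proof.
split=> [|a f g /asboolP[lf cf] /asboolP[lg cg]]; apply/asboolP; split.
- by move=> c x y; rewrite scaler0 addr0.
- exact: cst_continuous.
- move=> c x y; rewrite !fctE lf lg !scalerDr !scalerA (mulrC a c).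
  by rewrite -!addrA; congr (_ + _); rewrite addrCA.
- by move=> x; apply: cvgD; [apply: cvgZl_tmp; exact: cf|exact: cg].
Qed.

HB.instance Definition _ :=
  GRing.isSubmodClosed.Build R (X -> R^o) continuous_linear
    continuous_linear_submod_closed.

End Dual.

(* The topological dual X^* as a subspace of the module of all functions. *)
Record dual (R : realType) (X : normedModType R) := Dual {
  dual_fun :> X -> R^o;
  dual_funP : dual_fun \in continuous_linear }.

Section DualStructure.
Context (R : realType) (X : normedModType R).

HB.instance Definition _ := [isSub for @dual_fun R X].
HB.instance Definition _ := [Choice of dual X by <:].
HB.instance Definition _ := [SubChoice_isSubLmodule of dual X by <:].

End DualStructure.

(* The weak-star topology is the one induced by pointwise convergence. *)
Definition weak_star (R : realType) (X : normedModType R) : topologicalType :=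
  initial_topology (fun f : dual X => (dual_fun f : {ptws X -> R})).

Section Asymptotic.
Context {R : realType} {X : normedModType R}.

Definition subspace_of_dual (Y : set (dual X)) : Prop :=
  Y 0 /\ forall (a : R) (f g : dual X), Y f -> Y g -> Y (a *: f + g).

Definition finite_codim (Y : set (dual X)) : Prop :=
  exists (n : nat) (e : 'I_n -> dual X), forall f : dual X,
    exists a : 'I_n -> R, Y (f - \sum_(i < n) a i *: e i).

Definition cof_wstar : set (set (dual X)) :=
  [set Y | [/\ subspace_of_dual Y, closed (Y : set (weak_star X))
             & finite_codim Y]].

(* The norm on X^* dual to a norm N on X equivalent to the given one. *)
Definition dual_norm (N : X -> R) (f : dual X) : R :=
  sup [set `|f x| | x in [set x | N x <= 1]].

Definition unit_sphere (M : dual X -> R) : set (dual X) := [set f | M f = 1].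

Definition unconditional (M : dual X -> R) (C : R) (s : seq (dual X)) : Prop :=
  forall (a : nat -> R) (e : nat -> bool),
    M (\sum_(i < size s) ((-1) ^+ e i * a i) *: s`_i)
      <= C * M (\sum_(i < size s) a i *: s`_i).

(* Starting from the vectors s already chosen:
   exists X_1, forall x_1 in S_{X_1}, ..., exists X_k, forall x_k in S_{X_k},
   P (s, x_1, ..., x_k). *)
Fixpoint asymptotic_game (M : dual X -> R) (P : seq (dual X) -> Prop)
    (k : nat) (s : seq (dual X)) : Prop :=
  if k is k'.+1 then
    exists Y, cof_wstar Y /\
      forall y, (Y `&` unit_sphere M) y -> asymptotic_game M P k' (rcons s y)
  else P s.

Definition auc_star (M : dual X -> R) : Prop :=
  forall t : R, 0 < t ->
    (0 < ereal_inf [set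
           ereal_sup [set
             ereal_inf [set (M (x + t *: y) - 1)%:E
                       | y in Y `&` unit_sphere M]
           | Y in cof_wstar]
         | x in unit_sphere M])%E.

Definition equivalent_norm (N : X -> R) : Prop :=
  [/\ forall x y, N (x + y) <= N x + N y,
      forall (a : R) x, N (a *: x) = `|a| * N x,
      forall x, N x = 0 -> x = 0
    & exists a b : R, [/\ 0 < a, 0 < b
        & forall x, a * `|x| <= N x /\ N x <= b * `|x|]].

End Asymptotic.

Arguments cof_wstar {R} X.

Definition original_dual_norm (R : realType) (X : normedModType R) :
    dual X -> R := dual_norm (fun x : X => `|x|).

Definition wstar_unconditional_asymptotic_structure
    (R : realType) (X : normedModType R) : Prop :=
  exists C : R, 1 <= C /\
    forall n : nat, (0 < n)%N ->
      asymptotic_game (@original_dual_norm R X)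
        (unconditional (@original_dual_norm R X) C) n [::].

(* A simple graph with bottom and top, each edge being recorded with its
   orientation: tb_arc u v means that uv is an edge oriented from u to v. *)
Record tb_graph := TBGraph {
  vertex : Type;
  tb_arc : vertex -> vertex -> Prop;
  tb_bottom : vertex;
  tb_top : vertex }.

Definition tb_adjacent (G : tb_graph) (u v : vertex G) : Prop :=
  tb_arc u v \/ tb_arc v u.

Fixpoint walk (G : tb_graph) (n : nat) (u v : vertex G) : Prop :=
  if n is m.+1 then exists w, tb_adjacent u w /\ walk m w v else u = v.

(* Length of a shortest walk (0 if there is none; bundle graphs are
   connected). *)
Definition graph_dist (G : tb_graph) (u v : vertex G) : nat :=
  xget 0%N [set n | walk n u v /\ forall m, walk m u v -> (n <= m)%N].

Definition tb_iso (G H : tb_graph) : Prop :=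
  exists f : vertex G -> vertex H,
    [/\ bijective f, f (tb_bottom G) = tb_bottom H, f (tb_top G) = tb_top H
      & forall u v, tb_arc u v <-> tb_arc (f u) (f v)].

(* Quotient of V by the equivalence relation generated by r. *)
Definition glued (V : Type) (r : V -> V -> Prop) : Type :=
  {A : set V | exists x, A = clos_refl_sym_trans V r x}.

Definition glue_class (V : Type) (r : V -> V -> Prop) (x : V) : glued r :=
  exist _ (clos_refl_sym_trans V r x) (ex_intro _ x erefl).

(* Identification of the vertices related by r in the (possibly disconnected)
   graph a; parallel edges are merged. *)
Definition glued_graph (V : Type) (a r : V -> V -> Prop) (b t : V) : tb_graph :=
  {| vertex := glued r;
     tb_arc p q := exists x y, [/\ a x y, p = glue_class r x & q = glue_class r y];
     tb_bottom := glue_class r b;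
     tb_top := glue_class r t |}.

Definition edge_graph : tb_graph :=
  {| vertex := bool;
     tb_arc u v := u = false /\ v = true;
     tb_bottom := false;
     tb_top := true |}.

Section Series.
Variables G H : tb_graph.

Inductive series_arc : vertex G + vertex H -> vertex G + vertex H -> Prop :=
| series_arc_l u v : tb_arc u v -> series_arc (inl u) (inl v)
| series_arc_r u v : tb_arc u v -> series_arc (inr u) (inr v).

Inductive series_id : vertex G + vertex H -> vertex G + vertex H -> Prop :=
| series_id_mid : series_id (inl (tb_top G)) (inr (tb_bottom H)).

Definition series_graph : tb_graph :=
  glued_graph series_arc series_id (inl (tb_bottom G)) (inr (tb_top H)).

End Series.

Section Parallel.
Variable G : tb_graph.

Inductive parallel_arc : nat * vertex G -> nat * vertex G -> Prop :=
| parallel_arc_intro i u v : tb_arc u v -> parallel_arc (i, u) (i, v).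

Inductive parallel_id : nat * vertex G -> nat * vertex G -> Prop :=
| parallel_id_bottom i j : parallel_id (i, tb_bottom G) (j, tb_bottom G)
| parallel_id_top i j : parallel_id (i, tb_top G) (j, tb_top G).

Definition parallel_graph : tb_graph :=
  glued_graph parallel_arc parallel_id (0%N, tb_bottom G) (0%N, tb_top G).

End Parallel.

Section Slash.
Variables G H : tb_graph.

Definition arcs : Type := {p : vertex G * vertex G | tb_arc p.1 p.2}.

Let V : Type := (vertex G + arcs * vertex H)%type.

Inductive slash_arc : V -> V -> Prop :=
| slash_arc_intro e u v : tb_arc u v -> slash_arc (inr (e, u)) (inr (e, v)).

Inductive slash_id : V -> V -> Prop :=
| slash_id_bottom (e : arcs) :
    slash_id (inr (e, tb_bottom H)) (inl (proj1_sig e).1)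
| slash_id_top (e : arcs) :
    slash_id (inr (e, tb_top H)) (inl (proj1_sig e).2).

Definition slash : tb_graph :=
  glued_graph slash_arc slash_id (inl (tb_bottom G)) (inl (tb_top G)).

End Slash.

(* The n-th power, for n >= 1. *)
Definition slash_pow (G : tb_graph) (n : nat) : tb_graph :=
  iter n.-1 (slash G) G.

(* In Series s t, the copy of s is the lower one. *)
Inductive formation : Type :=
| Edge
| Series of formation & formation
| Parallel of formation.

Fixpoint formed (s : formation) : tb_graph :=
  match s with
  | Edge => edge_graph
  | Series s1 s2 => series_graph (formed s1) (formed s2)
  | Parallel s1 => parallel_graph (formed s1)
  end.

Fixpoint has_proper_parallel (s : formation) : Prop :=
  match s with
  | Edge => False
  | Series s1 s2 => has_proper_parallel s1 \/ has_proper_parallel s2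
  | Parallel s1 => has_proper_parallel s1 \/ ~ tb_iso (formed s1) edge_graph
  end.

Definition nontrivial_bundle_graph (G : tb_graph) : Prop :=
  exists s : formation, has_proper_parallel s /\ tb_iso (formed s) G.

(* The family is indexed by n >= 1; its 0-th member is ignored. *)
Definition equi_lipschitz_embeds (R : realType) (X : normedModType R)
    (M : nat -> tb_graph) : Prop :=
  exists (D : R) (f : forall n, vertex (M n) -> dual X) (s : nat -> R),
    1 <= D /\
    forall n, (0 < n)%N ->
      0 < s n /\
      forall x y : vertex (M n),
        s n * (graph_dist x y)%:R <= original_dual_norm (f n x - f n y) /\
        original_dual_norm (f n x - f n y) <= s n * D * (graph_dist x y)%:R.

(* Main.v *)
Require Import Defs.
From Stdlib Require Import Relation_Operators.
From mathcomp Require Import all_boot all_order all_algebra.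
From mathcomp Require Import all_classical all_reals all_analysis.
From mathcomp Require Import ring lra zify.

(** The proof rests on the Szlenk derivations of the dual ball, on a contraction
    property of bundle graphs, and on a coding of bundle graphs by a tree.

    From (1) to (2).  Let M be an AUC-star dual norm.  If the points w_i are
    separated, lie at distance at most 1 from p and at most b from q, then a
    weak-star cluster point w of the w_i splits w_i - p into w - p and a part that
    is nearly weak-star null but large in norm.  The AUC property makes M (w - p)
    smaller than 1 by a fixed amount, and lower semicontinuity gives M (q - w) <= b,
    so the trip from p to q is shorter than 1 + b by a fixed amount
    (auc_contract).  A non-trivial bundle graph G contains such a configuration
    (spider_formed).  When every edge of G is replaced by a copy of H, the ratio
    between the displacement of the ends and the height is therefore multiplied by
    at most some kap < 1 (displacement_slash).  After n substitutions the ratio is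
    at most kap ^+ n, and no lower Lipschitz estimate can hold for all n
    (auc_star_not_embeds).

    From (2) to (1).  A functional survives a derivation of mesh e when each of its
    weak-star neighbourhoods contains two members at distance at least e that
    survived the preceding ones (szlenk).

    Suppose first that for every mesh (1/2)^k some derivation is empty.  Score a
    member of the dual ball by a weighted count of the derivations that it
    survives.  Weak-star near f no score is much larger than that of f, and it is
    smaller by a fixed amount at functionals far from f in norm (score_local).
    The norm sup |g x| / (2 - score of g) on X is consequently asymptotically
    uniformly smooth (score_norm_smooth), and its dual norm is AUC-star
    (score_norm_auc).

    Suppose now that for some mesh e no derivation is empty.  Descending through
    the derivations while playing the asymptotic game gives a tree of vectors in
    the dual whose sums along branches are bounded, with arbitrary coefficients in
    [-1, 1] by unconditionality, and which is so close to biorthogonal to points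
    of X that the norm of a combination dominates each of its coefficients
    (dual_tree).  Bundle graphs fit onto such a tree: record the height of a vertex
    at the root and, for each parallel composition, its distance to the nearer end
    at the node that names its copy (codable_parallel).  Neighbours differ by at
    most 1 on a single branch, and one coordinate always controls the distance up
    to the factor 4.  All the powers of G are coded in this way
    (codable_slash_pow), so they embed with a common distortion
    (szlenk_embeds). *)

Set Implicit Arguments.
Unset Strict Implicit.
Unset Printing Implicit Defensive.

Import Order.TTheory GRing.Theory Num.Theory.
Import numFieldNormedType.Exports.

Local Open Scope classical_set_scope.

(** * Quotients and walks *)

Lemma glue_classP (V : Type) (r : V -> V -> Prop) (p : glued r) :
  exists x, p = glue_class r x.
Proof.
by case: p => A [x Ax]; exists x; exact: eq_exist.
Qed.

Lemma glue_class_eq (V : Type) (r : V -> V -> Prop) (x y : V) :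
  r x y -> glue_class r x = glue_class r y.
Proof.
move=> rxy; apply: eq_exist; rewrite predeqE => z; split=> h.
  by apply: rst_trans h; apply/rst_sym/rst_step.
by apply: rst_trans h; apply/rst_step.
Qed.

(** Choosing a representative keeps the compatibility of f with the gluing out of
    the definition; it enters through glue_mapE only. *)
Definition glue_map (V T : Type) (r : V -> V -> Prop) (f : V -> T)
    (p : glued r) : T :=
  f (projT1 (cid (glue_classP p))).

Lemma glue_mapE (V T : Type) (r : V -> V -> Prop) (f : V -> T) :
  (forall x y, r x y -> f x = f y) ->
  forall x, glue_map f (glue_class r x) = f x.
Proof.
move=> fr x; rewrite /glue_map; case: cid => y /= /(congr1 (@proj1_sig _ _)) /=.
move=> /(congr1 (fun A => A y)) e.
have : clos_refl_sym_trans V r x y by rewrite e; exact: rst_refl.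
elim=> {e}[? ? /fr //|//|? ? _ -> //|? ? ? _ -> _ -> //].
Qed.

Lemma glued_arc (V : Type) (a r : V -> V -> Prop) (b t x y : V) :
  a x y -> @tb_arc (glued_graph a r b t) (glue_class r x) (glue_class r y).
Proof. by exists x, y. Qed.

Fixpoint upwalk (G : tb_graph) (n : nat) (u v : vertex G) : Prop :=
  if n is m.+1 then exists w, tb_arc u w /\ upwalk m w v else u = v.

Lemma upwalk_cat (G : tb_graph) n m (u v w : vertex G) :
  upwalk n u v -> upwalk m v w -> upwalk (n + m) u w.
Proof.
elim: n u => [u -> //|n IH u [x [ux xv]] vw].
by exists x; split=> //; exact: IH.
Qed.

Lemma walk_cat (G : tb_graph) n m (u v w : vertex G) :
  walk n u v -> walk m v w -> walk (n + m) u w.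
Proof.
elim: n u => [u -> //|n IH u [x [ux xv]] vw].
by exists x; split=> //; exact: IH.
Qed.

Lemma upwalk_walk (G : tb_graph) n (u v : vertex G) :
  upwalk n u v -> walk n u v.
Proof.
by elim: n u => [//|n IH u [x [ux /IH xv]]]; exists x; split=> //; left.
Qed.

Lemma walk_sym (G : tb_graph) n (u v : vertex G) : walk n u v -> walk n v u.
Proof.
elim: n u => [u -> //|n IH u [x [ux /IH vx]]].
rewrite -addn1; apply: walk_cat vx _; exists u; split=> //.
by case: ux; [right|left].
Qed.

Section Homomorphism.
Variables (G H : tb_graph) (f : vertex G -> vertex H).
Hypothesis fP : forall u v, tb_arc u v -> tb_arc (f u) (f v).

Lemma upwalk_map n (u v : vertex G) : upwalk n u v -> upwalk n (f u) (f v).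
Proof.
elim: n u => [u -> //|n IH u [x [/fP ux /IH xv]]].
by exists (f x).
Qed.

Lemma walk_map n (u v : vertex G) : walk n u v -> walk n (f u) (f v).
Proof.
elim: n u => [u -> //|n IH u [x [ux /IH xv]]].
by exists (f x); split=> //; case: ux => /fP; [left|right].
Qed.

End Homomorphism.

Lemma graph_distP (G : tb_graph) n (u v : vertex G) : walk n u v ->
  walk (graph_dist u v) u v /\ graph_dist u v <= n.
Proof.
move=> nuv; rewrite /graph_dist.
have ex : exists n, `[< walk n u v >] by exists n; exact/asboolP.
case: (ex_minnP ex) => k /asboolP kuv kmin.
have := @xgetPex _ 0%N [set n | walk n u v /\ forall m, walk m u v -> n <= m].
case=> [|? km]; last by split=> //; exact: km.
by exists k; split=> // m /asboolP; exact: kmin.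
Qed.

(** * Gradings *)

(** Bundle graphs are graded: every vertex lies on a monotone path from bottom to
    top, and all these paths have the same length. *)
Definition grading (G : tb_graph) (h : nat) (ht : vertex G -> nat) : Prop :=
  [/\ ht (tb_bottom G) = 0, ht (tb_top G) = h,
      forall u v, tb_arc u v -> ht v = (ht u).+1
    & forall v, [/\ ht v <= h, upwalk (ht v) (tb_bottom G) v
                 & upwalk (h - ht v) v (tb_top G)]].

Lemma grading_edge : grading (G := edge_graph) 1 (fun b : bool => b : nat).
Proof.
split=> //= [u v [-> -> //]|[] /=]; split=> //=; by exists true.
Qed.

Section Series.
Variables G H : tb_graph.
Local Notation cls := (glue_class (series_id (G := G) (H := H))).

Definition series_lift (T : Type) (f : vertex G -> T) (g : vertex H -> T) :
    vertex (series_graph G H) -> T :=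
  glue_map (fun x => match x with inl u => f u | inr v => g v end).

Lemma series_liftE T (f : vertex G -> T) (g : vertex H -> T) :
  f (tb_top G) = g (tb_bottom H) ->
  (forall u, series_lift f g (cls (inl u)) = f u) /\
  (forall v, series_lift f g (cls (inr v)) = g v).
Proof.
by move=> fg; split=> x; rewrite /series_lift glue_mapE // => ? ? [].
Qed.

Lemma series_mid : cls (inl (tb_top G)) = cls (inr (tb_bottom H)).
Proof. exact/glue_class_eq/series_id_mid. Qed.

Lemma series_arcl u v : tb_arc u v ->
  @tb_arc (series_graph G H) (cls (inl u)) (cls (inl v)).
Proof. by move=> uv; apply: glued_arc; exact: series_arc_l. Qed.

Lemma series_arcr u v : tb_arc u v ->
  @tb_arc (series_graph G H) (cls (inr u)) (cls (inr v)).
Proof. by move=> uv; apply: glued_arc; exact: series_arc_r. Qed.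

Lemma series_ind (P : vertex (series_graph G H) -> Prop) :
  (forall u, P (cls (inl u))) -> (forall v, P (cls (inr v))) -> forall p, P p.
Proof. by move=> Pl Pr p; have [[u|v] ->] := glue_classP p. Qed.

Lemma series_arc_ind (P : vertex (series_graph G H) ->
    vertex (series_graph G H) -> Prop) :
  (forall u v, tb_arc u v -> P (cls (inl u)) (cls (inl v))) ->
  (forall u v, tb_arc u v -> P (cls (inr u)) (cls (inr v))) ->
  forall p q, tb_arc p q -> P p q.
Proof.
by move=> Pl Pr p q [x [y [[u v uv|u v uv] -> ->]]]; [exact: Pl|exact: Pr].
Qed.

(** A monotone path of the composition is one of G followed by one of H. *)
Lemma grading_series h1 h2 ht1 ht2 :
  grading (G := G) h1 ht1 -> grading (G := H) h2 ht2 ->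
  grading (G := series_graph G H) (h1 + h2)
    (series_lift ht1 (fun v => h1 + ht2 v)).
Proof.
move=> [b1 t1 a1 w1] [b2 t2 a2 w2].
have [El Er] : _ /\ _ := @series_liftE _ ht1 (fun v => h1 + ht2 v) ltac:(by rewrite t1 b2 addn0).
split.
- by rewrite El.
- by rewrite Er t2.
- apply: series_arc_ind => u v uv; first by rewrite !El (a1 _ _ uv).
  by rewrite !Er (a2 _ _ uv) addnS.
- apply: series_ind => x.
    have [lx bx xt] := w1 x; rewrite El; split; first by rewrite (leq_trans lx) ?leq_addr.
      exact: upwalk_map series_arcl _ _ _ bx.
    rewrite -addnBAC //; apply: upwalk_cat (upwalk_map series_arcl xt) _.
    rewrite series_mid; have [_ _] := w2 (tb_bottom H).
    by rewrite b2 subn0; exact: upwalk_map series_arcr _ _ _.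
  have [lx bx xt] := w2 x; rewrite Er; split; first by rewrite leq_add2l.
    apply: upwalk_cat (upwalk_map series_arcr bx).
    rewrite -series_mid; have [_ + _] := w1 (tb_top G).
    by rewrite t1; exact: upwalk_map series_arcl _ _ _.
  by rewrite subnDl; exact: upwalk_map series_arcr _ _ _ xt.
Qed.

End Series.

Section Parallel.
Variable G : tb_graph.
Local Notation cls := (glue_class (parallel_id (G := G))).

Definition parallel_lift (T : Type) (f : nat -> vertex G -> T) :
    vertex (parallel_graph G) -> T :=
  glue_map (fun x => f x.1 x.2).

Lemma parallel_liftE T (f : nat -> vertex G -> T) :
  (forall i j, f i (tb_bottom G) = f j (tb_bottom G)) ->
  (forall i j, f i (tb_top G) = f j (tb_top G)) ->
  forall i u, parallel_lift f (cls (i, u)) = f i u.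
Proof.
by move=> fb ft i u; rewrite /parallel_lift glue_mapE // => ? ? [] k l /=.
Qed.

Lemma parallel_bottom i : cls (i, tb_bottom G) = tb_bottom (parallel_graph G).
Proof. exact/glue_class_eq/parallel_id_bottom. Qed.

Lemma parallel_top i : cls (i, tb_top G) = tb_top (parallel_graph G).
Proof. exact/glue_class_eq/parallel_id_top. Qed.

Lemma parallel_arcs i u v : tb_arc u v ->
  @tb_arc (parallel_graph G) (cls (i, u)) (cls (i, v)).
Proof. by move=> uv; apply: glued_arc. Qed.

Lemma parallel_ind (P : vertex (parallel_graph G) -> Prop) :
  (forall i u, P (cls (i, u))) -> forall p, P p.
Proof. by move=> PP p; have [[i u] ->] := glue_classP p. Qed.

Lemma parallel_arc_ind (P : vertex (parallel_graph G) ->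
    vertex (parallel_graph G) -> Prop) :
  (forall i u v, tb_arc u v -> P (cls (i, u)) (cls (i, v))) ->
  forall p q, tb_arc p q -> P p q.
Proof. by move=> PP p q [x [y [[i u v uv] -> ->]]]; exact: PP. Qed.

Lemma grading_parallel h ht : grading (G := G) h ht ->
  grading (G := parallel_graph G) h (parallel_lift (fun _ => ht)).
Proof.
move=> [b t a w].
have E := @parallel_liftE _ (fun _ => ht) (fun _ _ => erefl) (fun _ _ => erefl).
split.
- by rewrite E.
- by rewrite E.
- by apply: parallel_arc_ind => i u v uv; rewrite !E; exact: a.
- apply: parallel_ind => i u; rewrite E; have [lu bu ut] := w u; split=> //.
    rewrite -(parallel_bottom i).
    exact: (@upwalk_map G (parallel_graph G) (fun u => cls (i, u)) (parallel_arcs i)).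
  rewrite -(parallel_top i).
  exact: (@upwalk_map G (parallel_graph G) (fun u => cls (i, u)) (parallel_arcs i)).
Qed.

End Parallel.

(** * The infinitely branching tree on the natural numbers *)

(** Every positive integer is 2 ^ r * (2 i + 1) in exactly one way. Taking the
    exponent r as its parent makes nat an infinitely branching tree with root 0,
    in which parents come before their children. *)
Definition child (r i : nat) : nat := 2 ^ r * i.*2.+1.

Fixpoint anc_fuel (k m : nat) : seq nat :=
  if k is k'.+1 then
    if m == 0 then [:: 0] else rcons (anc_fuel k' (logn 2 m)) m
  else [::].

(** The branch from the root to m, root first; the fuel suffices because parents
    decrease. *)
Definition anc (m : nat) : seq nat := anc_fuel m.+1 m.

Lemma parent_lt m : 0 < m -> logn 2 m < m.
Proof.
move=> m0; apply: (@leq_trans (2 ^ logn 2 m)); first exact: ltn_expl.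
by apply: dvdn_leq m0 _; exact: pfactor_dvdnn.
Qed.

Lemma anc_rcons m : 0 < m -> anc m = rcons (anc (logn 2 m)) m.
Proof.
have fuel k k' n : n < k -> n < k' -> anc_fuel k n = anc_fuel k' n.
  elim: k k' n => // k IH [//|k'] n nk nk' /=.
  case: eqP => // /eqP; rewrite -lt0n => /parent_lt pn.
  by rewrite (IH k' (logn 2 n)) //; apply: leq_trans pn _.
case: m => // m _; have pm := parent_lt (ltn0Sn m).
by rewrite {2}/anc -(fuel m.+1) //; exact: ltnSn.
Qed.

Lemma anc0 : anc 0 = [:: 0]. Proof. by []. Qed.

Lemma child_gt0 r i : 0 < child r i.
Proof. by rewrite muln_gt0 expn_gt0. Qed.

Lemma logn_child r i : logn 2 (child r i) = r.
Proof.
rewrite lognM ?expn_gt0 // pfactorK // lognE /= dvdn2 /= odd_double /=.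
exact: addn0.
Qed.

Lemma anc_child r i : anc (child r i) = rcons (anc r) (child r i).
Proof. by rewrite anc_rcons ?child_gt0 // logn_child. Qed.

Lemma child_inj r i j : child r i = child r j -> i = j.
Proof.
move=> /eqP; rewrite eqn_pmul2l ?expn_gt0 // => /eqP [] /(congr1 half).
by rewrite !doubleK.
Qed.

Lemma mem_anc_leq a m : a \in anc m -> a <= m.
Proof.
elim/ltn_ind: m => -[|m] IH; first by rewrite anc0 inE => /eqP ->.
rewrite anc_rcons // mem_rcons inE => /orP[/eqP -> //|].
by have pm := parent_lt (ltn0Sn m) => /(IH _ pm) /leq_trans; apply; exact: ltnW.
Qed.

Lemma mem_anc m : m \in anc m.
Proof. by case: m => // m; rewrite anc_rcons // mem_rcons mem_head. Qed.

Lemma anc_uniq m : uniq (anc m).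
Proof.
elim/ltn_ind: m => -[//|m] IH; rewrite anc_rcons // rcons_uniq.
have pm := parent_lt (ltn0Sn m).
rewrite IH // andbT; apply/negP => /mem_anc_leq.
by rewrite leqNgt pm.
Qed.

Lemma anc_take a m : a \in anc m -> anc a = take (size (anc a)) (anc m).
Proof.
elim/ltn_ind: m => -[|m] IH; first by rewrite anc0 inE => /eqP ->.
move=> am; move: (am); rewrite [in _ \in _]anc_rcons // mem_rcons inE.
move=> /orP[/eqP ->|/IH E]; first by rewrite take_size.
have pm := parent_lt (ltn0Sn m).
rewrite [anc m.+1]anc_rcons // -cats1 takel_cat -?E //.
by rewrite E ?size_take_min ?geq_minr.
Qed.

Lemma mem_anc_trans a b c : a \in anc b -> b \in anc c -> a \in anc c.
Proof. by move=> ab /anc_take E; move: ab; rewrite E => /mem_take. Qed.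

Lemma anc_last m : last 0 (anc m) = m.
Proof. by case: m => // m; rewrite anc_rcons // last_rcons. Qed.

Lemma anc_size_inj a b c : a \in anc c -> b \in anc c ->
  size (anc a) = size (anc b) -> a = b.
Proof.
move=> /anc_take Ea /anc_take Eb s.
by rewrite -(anc_last a) Ea s -Eb anc_last.
Qed.

Lemma size_anc_child r i : size (anc (child r i)) = (size (anc r)).+1.
Proof. by rewrite anc_child size_rcons. Qed.

Lemma child_notin r i j : i <> j -> child r i \notin anc (child r j).
Proof.
move=> ij; apply/negP => h; apply: ij; apply: (@child_inj r).
by apply: anc_size_inj h (mem_anc _) _; rewrite !size_anc_child.
Qed.

Lemma mem_anc_child r i : r \in anc (child r i).
Proof. by rewrite anc_child mem_rcons inE mem_anc orbT. Qed.

Lemma anc_extend l n : size (anc l) <= n ->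
  exists l', size (anc l') = n /\ l \in anc l'.
Proof.
elim: n => [|n IH].
  by case: l => // l; rewrite anc_rcons // size_rcons.
rewrite leq_eqVlt => /orP[/eqP E|/IH [l' [<- ll']]].
  by exists l; rewrite E mem_anc.
exists (child l' 0); rewrite size_anc_child; split=> //.
exact: mem_anc_trans ll' (mem_anc_child _ _).
Qed.

(** * Coding bundle graphs by the tree *)

Definition ndist (a b : nat) : nat := (a - b) + (b - a).

(** Codes of the vertices in a c_0-like space indexed by the tree. The height is
    one coordinate; phi r v gives the others, written strictly below the node r,
    so that r stays free for a parallel composition to use. Neighbours lie on a
    common branch (coding_arc), where the sums of vectors will be controlled from
    above, while one coordinate always detects the distance up to the factor 4
    (coding_walk). *)
Record coding (G : tb_graph) (h N : nat) (ht : vertex G -> nat)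
    (phi : nat -> vertex G -> nat -> nat) : Prop := Coding {
  coding_grading : grading h ht;
  coding_bottom : forall r, phi r (tb_bottom G) = fun=> 0;
  coding_top : forall r, phi r (tb_top G) = fun=> 0;
  coding_below : forall r v a, phi r v a <> 0 ->
    [/\ r \in anc a, r <> a & size (anc a) <= size (anc r) + N];
  coding_finite : forall r v, exists b, forall a, b <= a -> phi r v a = 0;
  coding_arc : forall r u v, tb_arc u v ->
    (forall a, ndist (phi r u a) (phi r v a) <= 1) /\
    exists l, [/\ size (anc l) <= size (anc r) + N, r \in anc l
                & forall a, a \notin anc l -> phi r u a = 0 /\ phi r v a = 0];
  coding_walk : forall r u v, exists n, walk n u v /\
    (n <= 4 * ndist (ht u) (ht v) \/
     exists a, n <= 4 * ndist (phi r u a) (phi r v a)) }.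

Definition codable (G : tb_graph) (h : nat) : Prop :=
  exists N ht phi, @coding G h N ht phi.

Lemma codable_edge : codable edge_graph 1.
Proof.
exists 0, (fun b : bool => b : nat), (fun _ _ _ => 0).
split=> //; first exact: grading_edge.
- by move=> r v; exists 0.
- move=> r u v _; split=> //; exists r; split=> //; [by rewrite addn0|exact: mem_anc].
- move=> r [] [] /=.
  + by exists 0; split=> //; left.
  + by exists 1; split; [exists false; split=> //; right|left].
  + by exists 1; split; [exists true; split=> //; left|left].
  + by exists 0; split=> //; left.
Qed.

(** Codes are pulled back along phi and walks are pushed forward along psi. *)
Lemma codable_retract (K B : tb_graph) (h : nat)
    (phi : vertex K -> vertex B) (psi : vertex B -> vertex K) :
  (forall u v, tb_arc u v -> tb_arc (phi u) (phi v)) ->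
  (forall u v, tb_arc u v -> tb_arc (psi u) (psi v)) ->
  cancel phi psi -> phi (tb_bottom K) = tb_bottom B ->
  phi (tb_top K) = tb_top B -> codable B h -> codable K h.
Proof.
move=> phiA psiA phiK phib phit [N [ht [c [[hb hh ha hw] cb ct cbel cf ca cw]]]].
exists N, (ht \o phi), (fun r => c r \o phi); split.
- split=> /=; [by rewrite phib|by rewrite phit|by move=> u v /phiA /ha|].
  move=> v; have [lv bv vt] := hw (phi v); split=> //.
    by rewrite -[v in upwalk _ _ v]phiK -[tb_bottom K]phiK phib; apply: upwalk_map bv.
  by rewrite -[v in upwalk _ v _]phiK -[tb_top K]phiK phit; apply: upwalk_map vt.
- by move=> r /=; rewrite phib.
- by move=> r /=; rewrite phit.
- by move=> r v a /cbel.
- by move=> r v; exact: cf.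
- by move=> r u v /phiA; exact: ca.
- move=> r u v; have [n [w hn]] := cw r (phi u) (phi v); exists n; split=> //.
  by rewrite -[u]phiK -[v]phiK; exact: walk_map.
Qed.

(** The two parts may use the same nodes: between vertices on different sides of
    the cut vertex the distance is exactly the difference of the heights. *)
Lemma codable_series (G H : tb_graph) h1 h2 :
  codable G h1 -> codable H h2 -> codable (series_graph G H) (h1 + h2).
Proof.
move=> [N1 [ht1 [c1 [g1 cb1 ct1 cbel1 cf1 ca1 cw1]]]].
move=> [N2 [ht2 [c2 [g2 cb2 ct2 cbel2 cf2 ca2 cw2]]]].
exists (N1 + N2), (series_lift ht1 (fun v => h1 + ht2 v)),
  (fun r => series_lift (c1 r) (c2 r)).
have E r := @series_liftE G H _ (c1 r) (c2 r) ltac:(by rewrite ct1 cb2).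
have [b1 t1 _ w1] := g1; have [b2 t2 _ w2] := g2.
have [Hl Hr] : _ /\ _ := @series_liftE G H _ ht1 (fun v => h1 + ht2 v) ltac:(by rewrite t1 b2 addn0).
split; first exact: grading_series.
- by move=> r; rewrite (E r).1.
- by move=> r; rewrite (E r).2.
- move=> r; apply: series_ind => v a; rewrite ?(E r).1 ?(E r).2.
    by move=> /cbel1 [? ? s]; split=> //; apply: leq_trans s _; rewrite addnA leq_addr.
  by move=> /cbel2 [? ? s]; split=> //; apply: leq_trans s _; rewrite addnCA leq_addl.
- by move=> r; apply: series_ind => v; rewrite ?(E r).1 ?(E r).2.
- move=> r; apply: series_arc_ind => u v uv; rewrite ?(E r).1 ?(E r).2.
    have [d [l [ls rl ln]]] := ca1 r _ _ uv; split=> //; exists l; split=> //.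
    by rewrite addnA (leq_trans ls) ?leq_addr.
  have [d [l [ls rl ln]]] := ca2 r _ _ uv; split=> //; exists l; split=> //.
  by rewrite addnCA (leq_trans ls) ?leq_addl.
- have cross u v : exists n : nat,
    walk n (glue_class (series_id (G := G) (H := H)) (inl u) : vertex (series_graph G H))
       (glue_class (series_id (G := G) (H := H)) (inr v)) /\ n = (h1 - ht1 u) + ht2 v.
    exists ((h1 - ht1 u) + ht2 v); split=> //; apply: walk_cat.
      have [_ _ /upwalk_walk] := w1 u; exact: walk_map (@series_arcl G H) _ _ _.
    rewrite series_mid; have [_ /upwalk_walk + _] := w2 v.
    exact: walk_map (@series_arcr G H) _ _ _.
  move=> r; apply: series_ind => u; apply: series_ind => v;
    rewrite ?Hl ?Hr ?(E r).1 ?(E r).2.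
  + have [n [w hn]] := cw1 r u v; exists n; split=> //.
    exact: walk_map (@series_arcl G H) _ _ _ w.
  + have [n [w hn]] := cross u v; exists n; split=> //; left.
    by have [] := w1 u; rewrite /ndist; lia.
  + have [n [w hn]] := cross v u; exists n; split; first exact: walk_sym.
    by left; have [] := w1 v; rewrite /ndist; lia.
  + have [n [w hn]] := cw2 r u v; exists n; split.
      exact: walk_map (@series_arcr G H) _ _ _ w.
    by case: hn => [hn|]; [left; move: hn; rewrite /ndist; lia|right].
Qed.

(** The i-th copy is coded below the i-th child of r, and that child records the
    distance to the nearer end. This value vanishes at both ends, so the gluing is
    respected. Vertices of different copies are joined through one of the ends,
    and the length of the shorter such walk is controlled by the larger of the two
    recorded values or by the difference of the heights. *)
Lemma codable_parallel (G : tb_graph) h :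
  codable G h -> codable (parallel_graph G) h.
Proof.
move=> [N [ht [c [g cb ct cbel cf ca cw]]]].
pose tent v := minn (ht v) (h - ht v).
pose f r i v a := (if a == child r i then tent v else 0) + c (child r i) v a.
have [b t harc w] := g.
have fb r i : f r i (tb_bottom G) = fun=> 0.
  by apply/funext => a; rewrite /f cb /tent b min0n; case: eqP.
have ft r i : f r i (tb_top G) = fun=> 0.
  by apply/funext => a; rewrite /f ct /tent t subnn minn0; case: eqP.
have E r := @parallel_liftE G _ (f r) ltac:(by move=> i j; rewrite !fb)
  ltac:(by move=> i j; rewrite !ft).
have Eh := @parallel_liftE G _ (fun _ => ht) (fun _ _ => erefl) (fun _ _ => erefl).
have c_self r v : c r v r = 0.
  by case: (c r v r =P 0) => [//|/cbel []].
have fN r i v a : child r i \notin anc a -> f r i v a = 0.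
  move=> na; rewrite /f; case: eqP => [e|_]; first by rewrite e mem_anc in na.
  by case: (c (child r i) v a =P 0) => [->//|/cbel [ia]]; rewrite ia in na.
exists N.+1, (parallel_lift (fun _ => ht)), (fun r => parallel_lift (f r)).
split; first exact: grading_parallel.
- by move=> r; rewrite -(parallel_bottom G 0) E fb.
- by move=> r; rewrite -(parallel_top G 0) E ft.
- move=> r; apply: parallel_ind => i v a; rewrite E => nz.
  have ia : child r i \in anc a by apply/negPn/negP => /(fN r i v a) /nz.
  split.
  + exact: mem_anc_trans (mem_anc_child _ _) ia.
  + move=> ra; rewrite -ra in ia; have := size_anc_child r i.
    by have /(congr1 size) := anc_take ia; rewrite size_take_min; lia.
  + move: nz; rewrite /f; case: eqP => [->|_].
      by rewrite size_anc_child addnS ltnS leq_addr.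
    by move=> /cbel [_ _]; rewrite size_anc_child addnS addSn.
- move=> r; apply: parallel_ind => i v; rewrite E.
  have [k kP] := cf (child r i) v; exists (maxn k (child r i).+1) => a.
  rewrite geq_max => /andP[ka ia]; rewrite /f kP // addn0.
  by case: eqP ia => // ->; rewrite ltnn.
- move=> r; apply: parallel_arc_ind => i u v uv; rewrite !E.
  have [d [l [ls rl ln]]] := ca (child r i) _ _ uv.
  have huv := harc _ _ uv.
  split=> [a|].
    rewrite /f; case: eqP => [->|_]; last by rewrite !add0n.
    by rewrite !c_self !addn0 /ndist /tent huv; lia.
  exists l; split.
  + by rewrite addnS -addSn -(size_anc_child r i).
  + exact: mem_anc_trans (mem_anc_child _ _) rl.
  + move=> a al; rewrite /f; have [-> ->] := ln _ al; rewrite !addn0.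
    by case: eqP al => // ->; rewrite rl.
- move=> r; apply: parallel_ind => i u; apply: parallel_ind => j v.
  rewrite !E !Eh; have [ij|ij] := eqVneq i j.
    subst j; have [n [wn hn]] := cw (child r i) u v; exists n; split.
      by apply: (@walk_map G (parallel_graph G)
        (fun u => glue_class (parallel_id (G := G)) (i, u))) wn; exact: parallel_arcs.
    case: hn => [hn|[a hn]]; [by left|right; exists a].
    rewrite /f; case: eqP hn => [->|_ //]; rewrite !c_self /ndist; lia.
  have [lu bu ut] := w u; have [lv bv vt] := w v.
  have wb : walk (ht u + ht v) (glue_class (parallel_id (G := G)) (i, u) : vertex (parallel_graph G))
      (glue_class (parallel_id (G := G)) (j, v)).
    apply: (@walk_cat _ _ _ _ (tb_bottom (parallel_graph G))).
      apply: walk_sym; rewrite -(parallel_bottom G i).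
      apply: (@walk_map G (parallel_graph G)
        (fun u => glue_class (parallel_id (G := G)) (i, u))) (upwalk_walk bu).
      exact: parallel_arcs.
    rewrite -(parallel_bottom G j).
    apply: (@walk_map G (parallel_graph G)
        (fun u => glue_class (parallel_id (G := G)) (j, u))) (upwalk_walk bv).
    exact: parallel_arcs.
  have wt : walk ((h - ht u) + (h - ht v))
      (glue_class (parallel_id (G := G)) (i, u) : vertex (parallel_graph G))
      (glue_class (parallel_id (G := G)) (j, v)).
    apply: (@walk_cat _ _ _ _ (tb_top (parallel_graph G))).
      rewrite -(parallel_top G i).
      apply: (@walk_map G (parallel_graph G)
        (fun u => glue_class (parallel_id (G := G)) (i, u))) (upwalk_walk ut).
      exact: parallel_arcs.
    apply: walk_sym; rewrite -(parallel_top G j).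
    apply: (@walk_map G (parallel_graph G)
        (fun u => glue_class (parallel_id (G := G)) (j, u))) (upwalk_walk vt).
    exact: parallel_arcs.
  have di : ndist (f r i u (child r i)) (f r j v (child r i)) = tent u.
    rewrite (fN r j) ?child_notin //; last by move/esym/eqP; rewrite (negbTE ij).
    by rewrite /f eqxx c_self /ndist; lia.
  have dj : ndist (f r i u (child r j)) (f r j v (child r j)) = tent v.
    rewrite (fN r i) ?child_notin //; last by move/eqP; rewrite (negbTE ij).
    by rewrite /f eqxx c_self /ndist; lia.
  case: (leqP (ht u + ht v) ((h - ht u) + (h - ht v))) => cmp.
    exists (ht u + ht v); split=> //.
    case: (leqP (ht u + ht v) (4 * ndist (ht u) (ht v))) => [|h1]; first by left.
    right; case: (leqP (tent u) (tent v)) => h2; [exists (child r j)|exists (child r i)].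
      by rewrite dj; move: cmp h1 h2; rewrite /tent /ndist; lia.
    by rewrite di; move: cmp h1 h2; rewrite /tent /ndist; lia.
  exists ((h - ht u) + (h - ht v)); split=> //.
  case: (leqP ((h - ht u) + (h - ht v)) (4 * ndist (ht u) (ht v))) => [|h1]; first by left.
  right; case: (leqP (tent u) (tent v)) => h2; [exists (child r j)|exists (child r i)].
    by rewrite dj; move: cmp h1 h2; rewrite /tent /ndist; lia.
  by rewrite di; move: cmp h1 h2; rewrite /tent /ndist; lia.
Qed.

(** * Substitution of a coded graph for the edges of a bundle graph *)

Section SlashLift.
Variables G H : tb_graph.
Local Notation cls := (glue_class (slash_id (G := G) (H := H))).

Definition slash_lift (T : Type) (f : vertex G -> T)
    (g : arcs G -> vertex H -> T) : vertex (slash G H) -> T :=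
  glue_map (fun x => match x with inl u => f u | inr eu => g eu.1 eu.2 end).

Lemma slash_liftE T (f : vertex G -> T) (g : arcs G -> vertex H -> T) :
  (forall e, g e (tb_bottom H) = f (proj1_sig e).1) ->
  (forall e, g e (tb_top H) = f (proj1_sig e).2) ->
  (forall u, slash_lift f g (cls (inl u)) = f u) /\
  (forall e u, slash_lift f g (cls (inr (e, u))) = g e u).
Proof.
by move=> gb gt; split=> *; rewrite /slash_lift glue_mapE // => ? ? [] e /=.
Qed.

Lemma slash_bottom e : cls (inr (e, tb_bottom H)) = cls (inl (proj1_sig e).1).
Proof. exact/glue_class_eq/slash_id_bottom. Qed.

Lemma slash_top e : cls (inr (e, tb_top H)) = cls (inl (proj1_sig e).2).
Proof. exact/glue_class_eq/slash_id_top. Qed.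

Lemma slash_arcs e u v : tb_arc u v ->
  @tb_arc (slash G H) (cls (inr (e, u))) (cls (inr (e, v))).
Proof. by move=> uv; apply: glued_arc. Qed.

Lemma slash_ind (P : vertex (slash G H) -> Prop) :
  (forall u, P (cls (inl u))) -> (forall e u, P (cls (inr (e, u)))) ->
  forall p, P p.
Proof. by move=> Pl Pr p; have [[u|[e u]] ->] := glue_classP p. Qed.

Lemma slash_arc_ind (P : vertex (slash G H) -> vertex (slash G H) -> Prop) :
  (forall e u v, tb_arc u v -> P (cls (inr (e, u))) (cls (inr (e, v)))) ->
  forall p q, tb_arc p q -> P p q.
Proof. by move=> PP p q [x [y [[e u v uv] -> ->]]]; exact: PP. Qed.

(** Codes pass to retracts, so it is enough to map slash G H to B and back with
    the composite equal to the identity. Both maps leave a quotient, hence no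
    analysis of equality between classes is needed. *)
Lemma codable_slash_retract (B : tb_graph) (h : nat) (f : vertex G -> vertex B)
    (psi : vertex B -> vertex (slash G H)) :
  codable B h ->
  (forall u v, tb_arc u v -> tb_arc (psi u) (psi v)) ->
  (forall a, psi (f a) = cls (inl a)) ->
  (forall e : arcs G, exists g : vertex H -> vertex B,
    [/\ forall u v, tb_arc u v -> tb_arc (g u) (g v),
        g (tb_bottom H) = f (proj1_sig e).1, g (tb_top H) = f (proj1_sig e).2
      & forall u, psi (g u) = cls (inr (e, u))]) ->
  f (tb_bottom G) = tb_bottom B -> f (tb_top G) = tb_top B ->
  codable (slash G H) h.
Proof.
move=> cB psiA psif /choice [g gP] fb ft.
have [El Er] : _ /\ _ := @slash_liftE _ f g
  ltac:(by move=> e; have [] := gP e) ltac:(by move=> e; have [] := gP e).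
apply: (@codable_retract _ _ _ (slash_lift f g) psi) => //.
- by apply: slash_arc_ind => e u v uv; rewrite !Er; have [gA _ _ _] := gP e; exact: gA.
- by apply: slash_ind => [u|e u]; rewrite ?El ?Er //; have [] := gP e.
- by rewrite /= El.
- by rewrite /= El.
Qed.

End SlashLift.

Section SlashMap.
Variables (G G' H : tb_graph) (f : vertex G -> vertex G').
Hypothesis fA : forall u v, tb_arc u v -> tb_arc (f u) (f v).

Definition arcs_map (e : arcs G) : arcs G' :=
  exist _ (f (proj1_sig e).1, f (proj1_sig e).2) (fA (proj2_sig e)).

Definition slash_map : vertex (slash G H) -> vertex (slash G' H) :=
  slash_lift (fun u => glue_class (slash_id (G := G') (H := H)) (inl (f u)))
    (fun e u => glue_class (slash_id (G := G') (H := H)) (inr (arcs_map e, u))).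

Lemma slash_mapE :
  (forall u, slash_map (glue_class (slash_id (G := G) (H := H)) (inl u)) =
             glue_class (slash_id (G := G') (H := H)) (inl (f u))) /\
  (forall e u, slash_map (glue_class (slash_id (G := G) (H := H)) (inr (e, u))) =
             glue_class (slash_id (G := G') (H := H)) (inr (arcs_map e, u))).
Proof.
by apply: slash_liftE => e; [rewrite slash_bottom|rewrite slash_top].
Qed.

Lemma slash_map_arcs p q : tb_arc p q -> tb_arc (slash_map p) (slash_map q).
Proof.
move: p q; apply: slash_arc_ind => e u v uv; rewrite !slash_mapE.2.
exact: slash_arcs.
Qed.

End SlashMap.

Arguments slash_map {G G'} H {f} fA _.

Lemma arcs_eq (G : tb_graph) (e e' : arcs G) :
  proj1_sig e = proj1_sig e' -> e = e'.
Proof. by case: e e' => p hp [q hq] /= pq; exact: eq_exist. Qed.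

Lemma codable_slash_edge (H : tb_graph) h :
  codable H h -> codable (slash edge_graph H) h.
Proof.
pose e0 : arcs edge_graph := exist _ (false, true) (conj erefl erefl).
have eE e : e = e0.
  by apply: arcs_eq; case: e => -[p q] /= [/= -> ->].
move=> cB; apply: (@codable_slash_retract _ _ _ _
  (fun b : vertex edge_graph => if b : bool then tb_top H else tb_bottom H)
  (fun u => glue_class (slash_id (G := edge_graph) (H := H)) (inr (e0, u))) cB) => //.
- by move=> u v; exact: slash_arcs.
- by move=> [] ; [rewrite slash_top|rewrite slash_bottom].
- by move=> e; exists id; rewrite (eE e).
Qed.

Lemma codable_slash_series (G1 G2 H : tb_graph) h1 h2 :
  codable (slash G1 H) h1 -> codable (slash G2 H) h2 ->
  codable (slash (series_graph G1 G2) H) (h1 + h2).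
Proof.
move=> c1 c2; have := codable_series c1 c2; clear c1 c2.
pose cls := glue_class (series_id (G := slash G1 H) (H := slash G2 H)).
pose c1 := glue_class (slash_id (G := G1) (H := H)).
pose c2 := glue_class (slash_id (G := G2) (H := H)).
pose f := series_lift (fun a => cls (inl (c1 (inl a)))) (fun b => cls (inr (c2 (inl b)))).
have fE := @series_liftE G1 G2 _ (fun a => cls (inl (c1 (inl a))))
  (fun b => cls (inr (c2 (inl b)))) (series_mid _ _).
pose psi := series_lift (slash_map H (@series_arcl G1 G2))
  (slash_map H (@series_arcr G1 G2)).
have psiE := @series_liftE (slash G1 H) (slash G2 H) _
  (slash_map H (@series_arcl G1 G2)) (slash_map H (@series_arcr G1 G2))
  ltac:(by rewrite (slash_mapE H (@series_arcl G1 G2)).1 (slash_mapE H (@series_arcr G1 G2)).1 series_mid).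
move=> cB; apply: (@codable_slash_retract _ _ (series_graph (slash G1 H) (slash G2 H)) _ f psi cB).
- apply: series_arc_ind => u v uv; rewrite /psi ?psiE.1 ?psiE.2; exact: slash_map_arcs.
- by apply: series_ind => a; rewrite /f /psi ?fE.1 ?fE.2 ?psiE.1 ?psiE.2
    (slash_mapE H _).1.
- move=> [[p q] pq].
  have : (exists (e : arcs G1), arcs_map (@series_arcl G1 G2) e = exist _ (p, q) pq) \/
         (exists (e : arcs G2), arcs_map (@series_arcr G1 G2) e = exist _ (p, q) pq).
    case: (pq) => x [y [[u v uv|u v uv] /= ep eq]]; subst p q.
      by left; exists (exist _ (u, v) uv); exact: arcs_eq.
    by right; exists (exist _ (u, v) uv); exact: arcs_eq.
  move=> [[e <-]|[e <-]] /=.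
  + exists (fun u => cls (inl (c1 (inr (e, u))))); split.
    * by move=> u v uv; apply: (@series_arcl (slash G1 H) (slash G2 H)); exact: slash_arcs.
    * by rewrite /f fE.1 /c1 slash_bottom.
    * by rewrite /f fE.1 /c1 slash_top.
    * by move=> u; rewrite /psi psiE.1 (slash_mapE H _).2.
  + exists (fun u => cls (inr (c2 (inr (e, u))))); split.
    * by move=> u v uv; apply: (@series_arcr (slash G1 H) (slash G2 H)); exact: slash_arcs.
    * by rewrite /f fE.2 /c2 slash_bottom.
    * by rewrite /f fE.2 /c2 slash_top.
    * by move=> u; rewrite /psi psiE.2 (slash_mapE H _).2.
- by rewrite /f /= fE.1.
- by rewrite /f /= fE.2.
Qed.

Lemma codable_slash_parallel (G H : tb_graph) h :
  codable (slash G H) h -> codable (slash (parallel_graph G) H) h.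
Proof.
move=> /codable_parallel.
pose cls i x := glue_class (parallel_id (G := slash G H)) (i, x).
pose c := glue_class (slash_id (G := G) (H := H)).
pose f := parallel_lift (fun i a => cls i (c (inl a))).
have fE := @parallel_liftE G _ (fun i a => cls i (c (inl a)))
  ltac:(by move=> i j; rewrite /cls !parallel_bottom)
  ltac:(by move=> i j; rewrite /cls !parallel_top).
pose psi := parallel_lift (fun i => slash_map H (@parallel_arcs G i)).
have psiE := @parallel_liftE (slash G H) _ (fun i => slash_map H (@parallel_arcs G i))
  ltac:(by move=> i j; rewrite /= !(slash_mapE H _).1 !parallel_bottom)
  ltac:(by move=> i j; rewrite /= !(slash_mapE H _).1 !parallel_top).
move=> cB; apply: (@codable_slash_retract _ _ (parallel_graph (slash G H)) _ f psi cB).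
- by apply: parallel_arc_ind => i u v uv; rewrite /psi !psiE; exact: slash_map_arcs.
- by apply: parallel_ind => i a; rewrite /f /psi fE psiE (slash_mapE H _).1.
- move=> [[p q] pq].
  have [i [e <-]] : exists i (e : arcs G), arcs_map (@parallel_arcs G i) e = exist _ (p, q) pq.
    case: (pq) => x [y [[i u v uv] /= ep eq]]; subst p q; exists i.
    by exists (exist _ (u, v) uv); exact: arcs_eq.
  exists (fun u => cls i (c (inr (e, u)))); split=> /=.
  + by move=> u v uv; apply: (@parallel_arcs (slash G H) i); exact: slash_arcs.
  + by rewrite /f fE /c slash_bottom.
  + by rewrite /f fE /c slash_top.
  + by move=> u; rewrite /psi psiE (slash_mapE H _).2.
- by rewrite /f /= fE; exact: (parallel_bottom (slash G H)).
- by rewrite /f /= fE; exact: (parallel_top (slash G H)).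
Qed.

Fixpoint fheight (s : formation) : nat :=
  match s with
  | Edge => 1
  | Series s1 s2 => fheight s1 + fheight s2
  | Parallel s1 => fheight s1
  end.

Lemma codable_formed s : codable (formed s) (fheight s).
Proof.
elim: s => [|s1 c1 s2 c2|s c] /=.
- exact: codable_edge.
- exact: codable_series.
- exact: codable_parallel.
Qed.

(** Substitution for the edges commutes with the operations that form bundle
    graphs. *)
Lemma codable_slash_formed s (H : tb_graph) h :
  codable H h -> codable (slash (formed s) H) (fheight s * h).
Proof.
move=> cH; elim: s => [|s1 c1 s2 c2|s c] /=.
- by rewrite mul1n; exact: codable_slash_edge.
- by rewrite mulnDl; exact: codable_slash_series.
- exact: codable_slash_parallel.
Qed.

Lemma codable_iso (G G' : tb_graph) h : tb_iso G G' -> codable G h -> codable G' h.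
Proof.
move=> [f [[g fg gf] fb ft fA]]; apply: (@codable_retract _ _ _ g f) => //.
- by move=> u v; rewrite fA !gf.
- by move=> u v /fA.
- by rewrite -fb fg.
- by rewrite -ft fg.
Qed.

Lemma codable_slash_iso (G G' H : tb_graph) h :
  tb_iso G G' -> codable (slash G H) h -> codable (slash G' H) h.
Proof.
move=> [f [[g fg gf] fb ft fA]].
have fA' u v : tb_arc u v -> tb_arc (f u) (f v) by move=> /fA.
have gA u v : tb_arc u v -> tb_arc (g u) (g v) by rewrite fA !gf.
have arcK e : arcs_map fA' (arcs_map gA e) = e.
  by apply: arcs_eq; case: e => -[p q] pq /=; rewrite !gf.
move=> cB; apply: (@codable_slash_retract _ _ (slash G H) _
  (fun a => glue_class (slash_id (G := G) (H := H)) (inl (g a))) (slash_map H fA') cB).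
- exact: slash_map_arcs.
- by move=> a; rewrite (slash_mapE H _).1 gf.
- move=> e; exists (fun u => glue_class (slash_id (G := G) (H := H)) (inr (arcs_map gA e, u))).
  split=> [u v|||u]; [exact: slash_arcs| | |].
  + by rewrite slash_bottom.
  + by rewrite slash_top.
  + by rewrite (slash_mapE H _).2 arcK.
- by rewrite /= -fb fg.
- by rewrite /= -ft fg.
Qed.

Lemma codable_slash_pow s (G : tb_graph) n : tb_iso (formed s) G ->
  codable (slash_pow G n.+1) (fheight s ^ n.+1).
Proof.
move=> sG; rewrite /slash_pow /=; elim: n => [|n IH] /=.
  exact: codable_iso sG (codable_formed s).
rewrite expnS; apply: codable_slash_iso sG _; exact: codable_slash_formed.
Qed.

(** * The branching inside a non-trivial bundle graph *)

(** The branching that shortens displacements: infinitely many monotone paths from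
    p to q through distinct vertices w i of the same height. *)
Definition spider (G : tb_graph) (k1 l1 l2 k2 : nat) : Prop :=
  exists (p q : vertex G) (w : nat -> vertex G),
    [/\ 0 < l1 /\ 0 < l2, upwalk k1 (tb_bottom G) p, upwalk k2 q (tb_top G),
        forall i, upwalk l1 p (w i) /\ upwalk l2 (w i) q & injective w].

Lemma grading1_edge (G : tb_graph) ht :
  grading (G := G) 1 ht -> tb_iso G edge_graph.
Proof.
move=> [hb hh ha hw].
have v0 v : ht v = 0 -> v = tb_bottom G.
  by move=> e; have [_ + _] := hw v; rewrite e => /= ->.
have v1 v : ht v = 1 -> v = tb_top G.
  by move=> e; have [_ _] := hw v; rewrite e.
exists (fun v => ht v == 1); split; [|by rewrite hb|by rewrite hh|].
  exists (fun b : bool => if b then tb_top G else tb_bottom G).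
    move=> v; case: eqP => [/v1 //|n1]; apply/esym/v0.
    by have [+ _ _] := hw v; lia.
  by case=> /=; rewrite ?hh ?hb.
move=> u v; split=> [uv|/= [/eqP u1 /eqP hv]].
  have := ha _ _ uv; have [+ _ _] := hw v; rewrite /=.
  by split; [apply/eqP; lia|apply/eqP; lia].
have hu : ht u = 0 by have [+ _ _] := hw u; lia.
rewrite (v0 _ hu) (v1 _ hv); have [_ _] := hw (tb_bottom G).
by rewrite hb /= => -[x [bx <-]].
Qed.

Lemma spider_map (G H : tb_graph) (f : vertex G -> vertex H) k1 l1 l2 k2 n m :
  (forall u v, tb_arc u v -> tb_arc (f u) (f v)) -> injective f ->
  upwalk n (tb_bottom H) (f (tb_bottom G)) ->
  upwalk m (f (tb_top G)) (tb_top H) ->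
  spider G k1 l1 l2 k2 -> spider H (n + k1) l1 l2 (k2 + m).
Proof.
move=> fA finj fb ft [p [q [w [l0 bp qt wP winj]]]].
exists (f p), (f q), (f \o w); split=> //.
- by apply: upwalk_cat fb _; exact: upwalk_map.
- by apply: upwalk_cat ft; exact: upwalk_map.
- by move=> i; have [? ?] := wP i; split; exact: upwalk_map.
- exact: inj_comp.
Qed.

(** A parallel composition of copies of a graph other than an edge has height at
    least 2, hence a vertex of height 1 different from both ends; its copies are
    the w i. The other operations preserve a spider. *)
Lemma spider_formed s : has_proper_parallel s ->
  exists k1 l1 l2 k2, spider (formed s) k1 l1 l2 k2.
Proof.
elim: s => //= [s1 IH1 s2 IH2|s IH].
  have [_ [ht1 [_ [[b1 t1 _ w1] _ _ _ _ _ _]]]] := codable_formed s1.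
  have [_ [ht2 [_ [[b2 t2 _ w2] _ _ _ _ _ _]]]] := codable_formed s2.
  case=> [/IH1|/IH2] [k1 [l1 [l2 [k2 sp]]]].
    exists (0 + k1), l1, l2, (k2 + fheight s2).
    apply: (@spider_map _ (series_graph (formed s1) (formed s2))
      (fun u => glue_class (series_id (G := formed s1) (H := formed s2)) (inl u))) sp => //.
    - exact: series_arcl.
    - have [+ _] := @series_liftE (formed s1) (formed s2) _ id (fun=> tb_top (formed s1)) erefl.
      exact: can_inj.
    - rewrite series_mid; have [_ _] := w2 (tb_bottom (formed s2)).
      rewrite b2 subn0; exact: upwalk_map (@series_arcr _ _) _ _ _.
  exists (fheight s1 + k1), l1, l2, (k2 + 0).
  apply: (@spider_map _ (series_graph (formed s1) (formed s2))
    (fun u => glue_class (series_id (G := formed s1) (H := formed s2)) (inr u))) sp => //.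
  - exact: series_arcr.
  - have [_ +] := @series_liftE (formed s1) (formed s2) _ (fun=> tb_bottom (formed s2)) id erefl.
    exact: can_inj.
  - rewrite -series_mid; have [_ + _] := w1 (tb_top (formed s1)).
    rewrite t1; exact: upwalk_map (@series_arcl _ _) _ _ _.
have [_ [ht [_ [g _ _ _ _ _ _]]]] := codable_formed s.
have [b t a w] := g.
case=> [/IH [k1 [l1 [l2 [k2 sp]]]]|niso].
  exists (0 + k1), l1, l2, (k2 + 0).
  apply: (@spider_map _ (parallel_graph (formed s))
    (fun u => glue_class (parallel_id (G := formed s)) (0, u))) sp => //.
  - exact: parallel_arcs.
  - exact: can_inj (@parallel_liftE (formed s) _ (fun _ => id) (fun _ _ => erefl) (fun _ _ => erefl) 0).
have hn1 : fheight s <> 1 by move=> e; apply: niso; apply: grading1_edge (ht) _; rewrite -e.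
have h0 : forall s, 0 < fheight s by elim=> //= s1 h1 s2 h2; rewrite addn_gt0 h1.
have {h0 hn1} h2 : 1 < fheight s by have := h0 s; lia.
have [_ _] := w (tb_bottom (formed s)); rewrite b subn0.
move: h2; case E : (fheight s) => [|[|h]] // _ [u [bu ut]].
have hu : ht u = 1 by rewrite (a _ _ bu) b.
exists 0, 1, h.+1, 0; exists (tb_bottom (parallel_graph (formed s))), (tb_top (parallel_graph (formed s))).
exists (fun i => glue_class (parallel_id (G := formed s)) (i, u)); split=> // [i|i j e].
  split; rewrite -?(parallel_bottom _ i) -?(parallel_top _ i).
    by apply: (@upwalk_map _ (parallel_graph (formed s))
      (fun u => glue_class (parallel_id (G := formed s)) (i, u)) _ 1) => //;
      [exact: parallel_arcs|exists u].
  by apply: (@upwalk_map _ (parallel_graph (formed s))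
      (fun u => glue_class (parallel_id (G := formed s)) (i, u)) _ h.+1) => //;
      exact: parallel_arcs.
pose f (i : nat) v := if (0 < ht v) && (ht v < fheight s) then i else 0.
have fE := @parallel_liftE (formed s) _ f ltac:(by move=> ? ?; rewrite /f b)
  ltac:(by move=> ? ?; rewrite /f t ltnn andbF).
by have := congr1 (parallel_lift f) e; rewrite !fE /f hu E.
Qed.

Lemma spider_nontrivial (G : tb_graph) s : has_proper_parallel s ->
  tb_iso (formed s) G -> exists k1 l1 l2 k2, spider G k1 l1 l2 k2.
Proof.
move=> /spider_formed [k1 [l1 [l2 [k2 sp]]]] [f [fbij fb ft fA]].
exists (0 + k1), l1, l2, (k2 + 0); apply: (@spider_map _ _ f) sp.
- by move=> u v /fA.
- exact: bij_inj.
- by rewrite fb.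
- by rewrite ft.
Qed.
Local Open Scope ring_scope.

(** * The dual space *)

Section Dual.
Variables (R : realType) (X : normedModType R).
Implicit Types (f g : dual X) (x y : X).

Lemma dual_lin f : linear f.
Proof. by have /asboolP[] := dual_funP f. Qed.

Lemma dual_cont f : continuous f.
Proof. by have /asboolP[] := dual_funP f. Qed.

Lemma dual0E x : (0 : dual X) x = 0. Proof. by []. Qed.
Lemma dualDE f g x : (f + g) x = f x + g x. Proof. by []. Qed.
Lemma dualBE f g x : (f - g) x = f x - g x. Proof. by []. Qed.
Lemma dualZE (a : R) f x : (a *: f) x = a * f x. Proof. by []. Qed.

Lemma dual_sumE (I : Type) (s : seq I) (P : pred I) (F : I -> dual X) x :
  (\sum_(i <- s | P i) F i) x = \sum_(i <- s | P i) (F i x : R).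
Proof. by elim/big_rec2: _ => // i y f _ <-. Qed.

Lemma dualP f g : (forall x, f x = g x) -> f = g.
Proof. by move=> fg; apply: val_inj; apply/funext. Qed.

Lemma dualD f x y : f (x + y) = f x + f y.
Proof. by have := dual_lin f 1 x y; rewrite !scale1r. Qed.

Lemma dual0 f : f 0 = 0.
Proof. by have := dualD f 0 0; rewrite addr0 => /eqP; rewrite -subr_eq0 opprD addrA subrr add0r oppr_eq0 => /eqP. Qed.

Lemma dualZ f (a : R) x : f (a *: x) = a * f x.
Proof. by have := dual_lin f a x 0; rewrite !addr0 dual0 addr0. Qed.

Lemma dualN f x : f (- x) = - f x.
Proof. by rewrite -scaleN1r dualZ mulN1r. Qed.

Lemma dualB f x y : f (x - y) = f x - f y.
Proof. by rewrite dualD dualN. Qed.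

Lemma dual_sum f (I : Type) (s : seq I) (P : pred I) (F : I -> X) :
  f (\sum_(i <- s | P i) F i) = \sum_(i <- s | P i) (f (F i) : R).
Proof. by elim/big_rec2: _ => [|i y x _ <-]; [exact: dual0|exact: dualD]. Qed.

Lemma dual_bounded f : exists2 c : R, 0 <= c & forall x, `|f x| <= c * `|x|.
Proof.
have /cvgrPdist_lt /(_ 1 ltr01) := @dual_cont f 0.
move=> /nbhs_ballP [e /= e0 eP].
exists (2 / e) => [|x]; first by rewrite divr_ge0 // ltW.
have [->|x0] := eqVneq x 0; first by rewrite dual0 !normr0 mulr0.
have nx : 0 < `|x| by rewrite normr_gt0.
pose a : R := e / 2 / `|x|.
have a0 : 0 < a by rewrite /a !divr_gt0.
have : `|f (a *: x)| < 1.
  have := eP (a *: x); rewrite /= -dualB sub0r dualN normrN; apply.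
  rewrite -ball_normE /= sub0r normrN normrZ gtr0_norm // /a divfK ?gt_eqF //.
  by rewrite ltr_pdivrMr // ltr_pMr // ltr1n.
rewrite dualZ normrM (gtr0_norm a0) mulrC -ltr_pdivlMr // => /ltW/le_trans; apply.
rewrite /a !invfM !invrK mul1r; lra.
Qed.

Lemma bounded_linear_dual (l : X -> R) (c : R) :
  (forall (a : R) x y, l (a *: x + y) = a * l x + l y) ->
  (forall x, `|l x| <= c * `|x|) ->
  exists f, forall x, f x = l x.
Proof.
move=> lin lb.
have lB x y : l (x - y) = l x - l y.
  by rewrite addrC -scaleN1r lin mulN1r addrC.
have c1 : 0 < `|c| + 1 by rewrite ltr_wpDl.
have cl : (l : X -> R^o) \in continuous_linear.
  apply/asboolP; split=> [a x y|x]; first exact: lin.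
  apply/cvgrPdist_lt => e e0; near=> y.
  rewrite -lB; apply: le_lt_trans (lb _) _.
  apply: (@le_lt_trans _ _ ((`|c| + 1) * `|x - y|)).
    by rewrite ler_wpM2r // ler_wpDr // ler_norm.
  rewrite mulrC -ltr_pdivlMr //; near: y.
  apply/nbhs_ballP; exists (e / (`|c| + 1)) => /= [|y]; first by rewrite divr_gt0.
  by rewrite -ball_normE.
by exists (Dual cl).
Unshelve. all: by end_near. Qed.

End Dual.

(** * Equivalent norms and their dual norms *)

Section DualNorm.
Variables (R : realType) (X : normedModType R) (N : X -> R).
Hypothesis HN : equivalent_norm N.
Implicit Types (f g : dual X) (x y : X).
Local Notation M := (dual_norm N).

Lemma eqnorm0 : N 0 = 0.
Proof. by have [_ h _ _] := HN; have := h 0 0; rewrite scale0r normr0 mul0r. Qed.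

Lemma eqnormZ (a : R) x : N (a *: x) = `|a| * N x.
Proof. by have [_ h _ _] := HN. Qed.

Lemma eqnorm_ge0 x : 0 <= N x.
Proof.
have [_ _ _ [a [b [a0 b0 h]]]] := HN; have [h1 _] := h x.
by apply: le_trans h1; rewrite mulr_ge0 // ltW.
Qed.

Lemma eqnorm_gt0 x : x != 0 -> 0 < N x.
Proof.
have [_ _ h _] := HN; move=> x0; rewrite lt_def eqnorm_ge0 andbT.
by apply: contra x0 => /eqP /h ->.
Qed.

Lemma dual_norm_has_sup f : has_sup [set `|f x| | x in [set x | N x <= 1]].
Proof.
split; first by exists `|f 0|, 0 => //=; rewrite eqnorm0 ler01.
have [c c0 fc] := dual_bounded f.
have [_ _ _ [a [b [a0 b0 h]]]] := HN.
exists (c / a) => _ [x /= Nx <-]; apply: le_trans (fc x) _.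
rewrite ler_wpM2l // -[leRHS]mul1r ler_pdivlMr // mulrC.
by have [+ _] := h x => /le_trans; exact.
Qed.

Lemma dual_norm_ge0 f : 0 <= M f.
Proof.
apply: sup_upper_bound (dual_norm_has_sup f) _ _; exists 0 => /=.
  by rewrite eqnorm0 ler01.
by rewrite dual0 normr0.
Qed.

Lemma dual_norm_ub f x : `|f x| <= M f * N x.
Proof.
have [->|x0] := eqVneq x 0.
  by rewrite dual0 normr0 mulr_ge0 ?dual_norm_ge0 ?eqnorm_ge0.
have nx := eqnorm_gt0 x0.
rewrite -ler_pdivrMr //.
apply: sup_upper_bound (dual_norm_has_sup f) _ _; exists ((N x)^-1 *: x) => /=.
  by rewrite eqnormZ gtr0_norm ?invr_gt0 // mulVf ?gt_eqF.
by rewrite dualZ normrM gtr0_norm ?invr_gt0 // mulrC.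
Qed.

Lemma dual_norm_le f (c : R) : 0 <= c ->
  (forall x, `|f x| <= c * N x) -> M f <= c.
Proof.
move=> c0 h; have [ne _] := dual_norm_has_sup f.
apply: ge_sup => // _ [x /= Nx <-]; apply: le_trans (h x) _.
by rewrite -[leRHS]mulr1 ler_wpM2l.
Qed.

Lemma dual_norm_gt f (c : R) : c < M f -> exists x, N x <= 1 /\ c < f x.
Proof.
move=> cM; have [ne _] := dual_norm_has_sup f.
have [_ [x /= Nx <-] cx] := sup_gt ne cM.
have [fx|fx] := leP 0 (f x); first by exists x; split=> //; rewrite ger0_norm in cx.
exists (- x); rewrite dualN; rewrite ltr0_norm // in cx; split=> //.
by rewrite -scaleN1r eqnormZ normrN normr1 mul1r.
Qed.

Lemma dual_normD f g : M (f + g) <= M f + M g.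
Proof.
apply: dual_norm_le => [|x]; first by rewrite addr_ge0 ?dual_norm_ge0.
rewrite dualDE mulrDl; apply: le_trans (ler_normD _ _) _.
by rewrite lerD ?dual_norm_ub.
Qed.

Lemma dual_normZ (a : R) f : M (a *: f) = `|a| * M f.
Proof.
have half b g : M (b *: g) <= `|b| * M g.
  apply: dual_norm_le => [|x]; first by rewrite mulr_ge0 ?dual_norm_ge0.
  by rewrite dualZE normrM -mulrA ler_wpM2l ?dual_norm_ub.
apply/eqP; rewrite eq_le half /=.
have [->|a0] := eqVneq a 0; first by rewrite normr0 mul0r dual_norm_ge0.
rewrite -ler_pdivlMl ?normr_gt0 // -normfV; apply: le_trans (half _ _).
by rewrite scalerA mulVf // scale1r.
Qed.

Lemma dual_normN f : M (- f) = M f.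
Proof. by rewrite -scaleN1r dual_normZ normrN normr1 mul1r. Qed.

Lemma dual_norm0 : M 0 = 0.
Proof. by rewrite -[0 in LHS](scale0r 0) dual_normZ normr0 mul0r. Qed.

Lemma dual_norm_distC f g : M (f - g) = M (g - f).
Proof. by rewrite -dual_normN opprB. Qed.

Lemma dual_norm_tri f g : M f <= M (f - g) + M g.
Proof. by rewrite -[f in leLHS](subrK g) dual_normD. Qed.

Lemma dual_norm_sum (I : Type) (s : seq I) (P : pred I) (F : I -> dual X) :
  M (\sum_(i <- s | P i) F i) <= \sum_(i <- s | P i) M (F i).
Proof.
elim/big_rec2: _ => [|i y f _ h]; first by rewrite dual_norm0.
by apply: le_trans (dual_normD _ _) _; rewrite lerD2l.
Qed.

Lemma dual_norm_eq0 f : M f = 0 -> f = 0.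
Proof.
move=> f0; apply: dualP => x; apply/eqP; rewrite -normr_le0.
by have := dual_norm_ub f x; rewrite f0 mul0r.
Qed.

Lemma dual_norm_gt0 f : f != 0 -> 0 < M f.
Proof.
move=> f0; rewrite lt_def dual_norm_ge0 andbT.
by apply: contra f0 => /eqP /dual_norm_eq0 ->.
Qed.

Lemma dual_norm_normalize f : f != 0 -> M ((M f)^-1 *: f) = 1.
Proof.
move=> /dual_norm_gt0 f0.
by rewrite dual_normZ gtr0_norm ?invr_gt0 // mulVf ?gt_eqF.
Qed.

End DualNorm.

Lemma equivalent_norm_id (R : realType) (X : normedModType R) :
  equivalent_norm (fun x : X => `|x|).
Proof.
split=> [x y|a x|x /eqP|].
- exact: ler_normD.
- exact: normrZ.
- by rewrite normr_eq0 => /eqP.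
- by exists 1, 1; split=> // x; rewrite !mul1r.
Qed.

(** * The weak-star topology *)

Section WeakStar.
Variables (R : realType) (X : normedModType R).
Implicit Types (f g : dual X) (x y : X).

Definition wnear (xs : seq X) (e : R) (f g : dual X) : Prop :=
  forall x, x \in xs -> `|g x - f x| < e.

(** The sets described on the right form a filter that converges to l at every
    point, hence in the product topology. *)
Lemma ptws_nbhsP (l : {ptws X -> R}) (A : set {ptws X -> R}) :
  nbhs l A -> exists xs : seq X, exists2 e : R, 0 < e &
    forall g : X -> R, (forall x, x \in xs -> `|g x - l x| < e) -> A g.
Proof.
pose F := [set A : set (X -> R) | exists xs : seq X, exists2 e : R, 0 < e &
    forall g : X -> R, (forall x, x \in xs -> `|g x - l x| < e) -> A g].
have FF : Filter F.
  split.
  - by exists [::], 1.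
  - move=> P Q [xs [e e0 h]] [xs' [e' e'0 h']].
    exists (xs ++ xs'); exists (Num.min e e'); first by rewrite lt_min e0.
    move=> g gP; split; [apply: h|apply: h'] => x xin;
      have := gP x; rewrite mem_cat xin ?orbT lt_min => /(_ isT) /andP[] //.
  - by move=> P Q PQ [xs [e e0 h]]; exists xs, e => // g /h /PQ.
have : {ptws, F --> l}.
  apply/pointwise_cvgP => t B /nbhs_ballP [e /= e0 eB].
  exists [:: t]; exists e => // g gP; apply: eB.
  by rewrite /ball /= distrC; apply: gP; rewrite mem_head.
by move=> Fl /Fl.
Qed.

Lemma ptws_nbhs (l : {ptws X -> R}) (xs : seq X) (e : R) : 0 < e ->
  nbhs l [set g : {ptws X -> R} | forall x, x \in xs -> `|g x - l x| < e].
Proof.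
move=> e0; elim: xs => [|x xs IH]. by apply: (@filterS _ _ _ setT); [|exact: filterT].
have pc : nbhs l (proj x @^-1` (ball (l x : R) e)).
  apply: (@proj_continuous X (fun=> R) x l).
  exact: (nbhsx_ballx _ _ e0).
have pI := @filterI _ (nbhs l) (nbhs_filter l) _ _ pc IH.
apply: (@filterS _ (nbhs l) (nbhs_filter l) _ _ _ pI).
move=> g [gx IHg] y; rewrite inE => /orP[/eqP ->|]; last exact: IHg.
by have := gx; rewrite /= /ball /= distrC.
Qed.

Lemma wstar_nbhsP (f : weak_star X) (A : set (weak_star X)) :
  nbhs f A <-> exists xs : seq X, exists2 e : R, 0 < e &
    forall g, wnear xs e f g -> A g.
Proof.
split.
  rewrite nbhsE => -[B [[C Co <-] Cf] BA].
  have : nbhs (dual_fun f : {ptws X -> R}) C by apply: open_nbhs_nbhs.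
  by move=> /ptws_nbhsP [xs [e e0 h]]; exists xs, e => // g gP; apply: BA; exact: h.
move=> [xs [e e0 h]].
have := @initial_continuous _ _ (fun f : dual X => (dual_fun f : {ptws X -> R})) f.
move=> /(_ _ (ptws_nbhs (dual_fun f) xs e0)) fA.
by apply: (@filterS _ (nbhs f) (nbhs_filter f) _ _ _ fA).
Qed.

(** Banach-Alaoglu. Tychonoff gives a pointwise cluster point l of the filter; the
    linear relations and the bound are tested at finitely many points, so they
    pass to l. *)
Lemma wstar_ball_compact (c : R) :
  compact ([set f : dual X | forall x, `|f x| <= c * `|x|] : set (weak_star X)).
Proof.
move=> F PF FB.
pose ev := fun f : weak_star X => (dual_fun f : {ptws X -> R}).
pose A x : set R := [set` `[- (c * `|x|), c * `|x|]%R].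
have := @tychonoff X (fun=> R) A (fun x => @segment_compact _ _ _).
have GA : (ev @ F) [set l : X -> R | forall x, A x (l x)].
  suff sub : [set f : weak_star X | forall x, `|dual_fun f x| <= c * `|x|] `<=`
      ev @^-1` [set l : X -> R | forall x, A x (l x)] by exact: (@filterS _ F _ _ _ sub FB).
  move=> f /= fb x.
  have := fb x; rewrite ler_norml => fx.
  by change (is_true (dual_fun f x \in `[- (c * `|x|), c * `|x|]%R)); rewrite in_itv.
move=> /(_ (ev @ F) _ GA) [l [lA lcl]].
have approx (xs : seq X) (e : R) (e0 : 0 < e) (B : set (weak_star X)) : F B ->
    exists f : dual X, B f /\ forall x, x \in xs -> `|f x - l x| < e.
  move=> FBB; have [| _ [[f Bf <-] fl]] := lcl (ev @` B) _ _ (ptws_nbhs l xs e0).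
    suff sub : B `<=` ev @^-1` (ev @` B) by exact: (@filterS _ F _ _ _ sub FBB).
    by move=> f Bf; exists f.
  by exists f.
have lb x : `|l x| <= c * `|x|.
  by have := lA x; rewrite /A /= in_itv /= -ler_norml.
have lin (a : R) x y : l (a *: x + y) = a * l x + l y.
  apply/eqP; rewrite -subr_eq0 -normr_le0; apply/ler_addgt0Pr => e e0; rewrite add0r.
  have k0 : 0 < `|a| + 2 by rewrite ltr_wpDl.
  have [f [_ fP]] := approx [:: a *: x + y; x; y] (e / (`|a| + 2)) (divr_gt0 e0 k0) setT filterT.
  have f1 := fP (a *: x + y) ltac:(by rewrite !inE eqxx).
  have f2 := fP x ltac:(by rewrite !inE eqxx orbT).
  have f3 := fP y ltac:(by rewrite !inE eqxx !orbT).
  have -> : l (a *: x + y) - (a * l x + l y) =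
     (l (a *: x + y) - f (a *: x + y)) + (a * (f x - l x)) + (f y - l y).
    by rewrite dualD dualZ; ring.
  apply: le_trans (ler_normD _ _) _; apply: le_trans (lerD (ler_normD _ _) (lexx _)) _.
  rewrite normrM distrC.
  apply: le_trans (_ : _ <= e / (`|a| + 2) + `|a| * (e / (`|a| + 2)) + e / (`|a| + 2)) _.
    apply: lerD; last exact: ltW.
    by apply: lerD; [exact: ltW|apply: ler_wpM2l => //; exact: ltW].
  by rewrite le_eqVlt; apply/orP; left; apply/eqP; field; rewrite gt_eqF.
have [f fl] := bounded_linear_dual lin lb.
exists f; split; first by move=> x /=; rewrite fl.
move=> B C FBB /wstar_nbhsP [xs [e e0 h]].
have [g [Bg gl]] := approx xs e e0 B FBB.
by exists g; split=> //; apply: h => x xin; rewrite fl; exact: gl.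
Qed.

(** Without a finite subcover, the parts of the ball that avoid finitely many of
    the neighbourhoods would generate a filter without cluster point. *)
Lemma wstar_ball_cover (c : R) (xs : dual X -> seq X) (e : dual X -> R) :
  (forall f, 0 < e f) ->
  exists fs : seq (dual X),
    (forall f, f \in fs -> forall x, `|f x| <= c * `|x|) /\
    forall g : dual X, (forall x, `|g x| <= c * `|x|) ->
      exists2 f, f \in fs & wnear (xs f) (e f) f g.
Proof.
move=> e0; apply: contrapT => ncov.
pose D := [set f : dual X | forall x, `|f x| <= c * `|x|].
pose away (fs : seq (dual X)) g := D g /\ forall f, f \in fs -> ~ wnear (xs f) (e f) f g.
pose F : set_system (weak_star X) := [set B | exists fs : seq (dual X),
  (forall f, f \in fs -> D f) /\ forall g, away fs g -> B g].
have FF : ProperFilter F.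
  split.
    move=> [fs [fsD fsP]]; apply: ncov; exists fs; split=> // g Dg.
    apply: contrapT => ng; apply: (fsP g); split=> // f ffs gf.
    by apply: ng; exists f.
  split.
  - by exists [::].
  - move=> P Q [fs [fsD fsP]] [gs [gsD gsP]]; exists (fs ++ gs); split.
      by move=> f; rewrite mem_cat => /orP[/fsD|/gsD].
    move=> g [Dg aw]; split; [apply: fsP|apply: gsP]; split=> // f ff;
      by apply: aw; rewrite mem_cat ff ?orbT.
  - by move=> P Q PQ [fs [fsD fsP]]; exists fs; split=> // g /fsP /PQ.
have [|f [Df fcl]] := @wstar_ball_compact c F FF.
  by exists [::]; split=> // g [].
have Fa : F [set g | away [:: f] g].
  by exists [:: f]; split=> // g; rewrite inE => /eqP ->.
have [|g [/= [Dg ag] gf]] := fcl _ [set g | wnear (xs f) (e f) f g] Fa.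
  by apply/wstar_nbhsP; exists (xs f), (e f).
by apply: (ag f) gf; rewrite mem_head.
Qed.

Lemma wstar_ball_cluster (c : R) (w : nat -> dual X) :
  (forall n x, `|w n x| <= c * `|x|) ->
  exists f, (forall x, `|f x| <= c * `|x|) /\
    forall xs e n, 0 < e -> exists2 i, (n <= i)%N & wnear xs e f (w i).
Proof.
move=> wb; have := @wstar_ball_compact c.
move=> /(_ ((w : nat -> weak_star X) @ \oo) _) [|f [fb fcl]].
  by exists 0%N => // n _ x; exact: wb.
exists f; split=> // xs e n e0.
have [||_ [[i /= ni <-] wi]] := fcl (w @` [set i | (n <= i)%N]) [set g | wnear xs e f g].
- by exists n => // i ni; exists i.
- by apply/wstar_nbhsP; exists xs, e.
- by exists i.
Qed.

End WeakStar.

Section HahnBanach.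
Variables (R : realType) (X : normedModType R).

(** The graph of a linear functional on a subspace; the domination by the norm
    forces single values. *)
Definition dominated (A : set (X * R)) : Prop :=
  (forall (a : R) p q, A p -> A q -> A (a *: p.1 + q.1, a * p.2 + q.2)) /\
  (forall p, A p -> p.2 <= `|p.1|).

(** A value c at y is allowed when it lies above every q.2 - |q.1 - y| and below
    every |q.1 + y| - q.2; the triangle inequality makes room for it. *)
Lemma dominated_extend (A : set (X * R)) (y : X) : A !=set0 -> dominated A ->
  exists c : R, dominated [set p | exists q (t : R), A q /\
                             p = (q.1 + t *: y, q.2 + t * c)].
Proof.
move=> [p0 Ap0] [Alin Adom].
pose S := [set q.2 - `|q.1 - y| | q in A].
have Sub q : A q -> ubound S (`|q.1 + y| - q.2).
  move=> Aq _ [p Ap <-]; rewrite lerBlDr addrAC lerBrDr.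
  have := Adom _ (Alin 1 _ _ Ap Aq); rewrite /= scale1r mul1r => /le_trans; apply.
  have -> : p.1 + q.1 = (q.1 + y) + (p.1 - y).
    by rewrite [RHS]addrACA subrr addr0 addrC.
  exact: ler_normD.
have Sne : S !=set0 by exists (p0.2 - `|p0.1 - y|), p0.
pose c := sup S.
have clo q : A q -> q.2 - `|q.1 - y| <= c.
  move=> Aq; apply: sup_upper_bound; last by exists q.
  by split=> //; exists (`|p0.1 + y| - p0.2); exact: Sub.
have cup q : A q -> c <= `|q.1 + y| - q.2.
  by move=> Aq; apply: ge_sup => //; exact: Sub.
have A0 : A (0, 0).
  have := Alin (-1) p0 p0 Ap0 Ap0.
  by rewrite scaleN1r addNr mulN1r addNr.
have Ascale (a : R) q : A q -> A (a *: q.1, a * q.2).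
  by move=> Aq; have := Alin a _ _ Aq A0; rewrite !addr0.
exists c; split.
  move=> a _ _ [p [s [Ap ->]]] [q [t [Aq ->]]] /=.
  exists (a *: p.1 + q.1, a * p.2 + q.2), (a * s + t); split; first exact: Alin.
  congr pair => /=; last by ring.
  by rewrite scalerDr scalerDl scalerA addrACA.
move=> _ [q [t [Aq ->]]] /=.
have [t0|t0|->] := ltrgtP t 0; last by rewrite scale0r mul0r !addr0; exact: Adom.
  have nt : 0 < - t by rewrite oppr_gt0.
  have := clo _ (Ascale ((- t)^-1) _ Aq); rewrite /=.
  have -> : (- t)^-1 *: q.1 - y = (- t)^-1 *: (q.1 + t *: y).
    by rewrite scalerDr scalerA invrN mulNr mulVf ?lt_eqF // scaleN1r.
  rewrite normrZ (gtr0_norm (_ : 0 < (- t)^-1)) ?invr_gt0 // -mulrBr ler_pdivrMl //.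
  by rewrite mulNr; lra.
have := cup _ (Ascale t^-1 _ Aq); rewrite /=.
have -> : t^-1 *: q.1 + y = t^-1 *: (q.1 + t *: y).
  by rewrite scalerDr scalerA mulVf ?gt_eqF // scale1r.
by rewrite normrZ (gtr0_norm (_ : 0 < t^-1)) ?invr_gt0 // -mulrBr ler_pdivlMl //; lra.
Qed.

(** L is the graph of t x0 |-> t |x0|. Zorn's lemma is applied to the sets A for
    which L together with A is dominated, so that the empty chain needs no
    separate bound. *)
Lemma hahn_banach (x0 : X) :
  exists f : dual X, (forall x, `|f x| <= `|x|) /\ f x0 = `|x0|.
Proof.
pose L := [set p : X * R | exists t : R, p = (t *: x0, t * `|x0|)].
have Ldom : dominated L.
  split=> [a _ _ [s ->] [t ->] /=|_ [t ->] /=].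
    by exists (a * s + t); rewrite scalerDl mulrDl !scalerA mulrA.
  by rewrite normrZ ler_wpM2r // ler_norm.
have L0 : L (0, 0) by exists 0; rewrite scale0r mul0r.
pose P A := dominated (L `|` A).
have [F FP Ftot|A [PA Amax]] := @Zorn_bigcup _ P.
  have chain p q : (L `|` \bigcup_(A in F) A) p -> (L `|` \bigcup_(A in F) A) q ->
      exists B, [/\ dominated B, B `<=` L `|` \bigcup_(A in F) A, B p & B q].
    have sub A : F A -> (L `|` A) `<=` (L `|` \bigcup_(A in F) A).
      by move=> FA z [|] Az; [left|right; exists A].
    move=> [Lp|[A FA Ap]] [Lq|[B FB Bq]].
    - by exists L; split=> // z Lz; left.
    - by exists (L `|` B); split; [exact: FP|exact: sub|left|right].
    - by exists (L `|` A); split; [exact: FP|exact: sub|right|left].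
    - have [AB|BA] := Ftot _ _ FA FB.
        by exists (L `|` B); split; [exact: FP|exact: sub|right; exact: AB|right].
      by exists (L `|` A); split; [exact: FP|exact: sub|right|right; exact: BA].
  split=> [a p q Up Uq|p Up].
    by have [B [[Bl _] BU Bp Bq]] := chain _ _ Up Uq; apply: BU; exact: Bl.
  by have [B [[_ Bd] BU Bp _]] := chain _ _ Up Up; exact: Bd.
pose M := L `|` A.
have tot y : exists r, M (y, r).
  apply: contrapT => ny.
  have [|c Dc] := @dominated_extend M y _ PA; first by exists (0, 0); left.
  set B := [set p | _] in Dc.
  have MB : M `<=` B.
    by move=> p Mp; exists p, 0; rewrite scale0r mul0r !addr0; case: p Mp.
  have By : B (y, c).
    by exists (0, 0), 1; split; [left|rewrite scale1r mul1r !add0r].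
  apply: (Amax B).
    split; first by move=> p Ap; apply: MB; right.
    by move=> BA; apply: ny; exists c; right; exact: BA.
  rewrite /P; have -> // : L `|` B = B.
  by rewrite predeqE => p; split=> [[Lp|//]|]; [apply: MB; left|right].
have [Mlin Mdom] := PA.
have uniqM y r s : M (y, r) -> M (y, s) -> r <= s.
  move=> Mr Ms; have := Mdom _ (Mlin (-1) _ _ Ms Mr).
  by rewrite /= scaleN1r addNr normr0 mulN1r addrC subr_le0.
have [l lM] := choice tot.
have lE y r : M (y, r) -> l y = r.
  by move=> My; apply/eqP; rewrite eq_le (uniqM y) // (uniqM y).
have llin (a : R) x y : l (a *: x + y) = a * l x + l y.
  by apply: lE; exact: (Mlin a _ _ (lM x) (lM y)).
have lb x : `|l x| <= 1 * `|x|.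
  rewrite mul1r ler_norml (Mdom _ (lM x)) andbT lerNl.
  have := Mdom _ (lM (- x)); rewrite /= normrN; apply: le_trans.
  have := llin (-1) x 0; have -> : l 0 = 0 by apply: lE; left.
  by rewrite scaleN1r !addr0 mulN1r => ->.
have [f fl] := bounded_linear_dual llin lb.
exists f; split=> [x|]; first by rewrite fl -[leRHS]mul1r.
by rewrite fl; apply: lE; left; exists 1; rewrite scale1r mul1r.
Qed.

End HahnBanach.

(** * Weak-star closed subspaces of finite codimension *)

Section Separation.
Variables (K : fieldType) (m : nat) (V : set 'rV[K]_m).
Hypothesis V0 : V 0.
Hypothesis Vlin : forall a u v, V u -> V v -> V (a *: u + v).

(** A matrix of maximal rank among those with row space contained in V. *)
Lemma rowspace_set : exists A : 'M[K]_m, forall u, V u <-> (u <= A)%MS.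
Proof.
pose P r := `[< exists A : 'M[K]_m, (forall u : 'rV_m, (u <= A)%MS -> V u) /\ \rank A = r >].
have P0 : exists r, P r.
  exists 0%N; apply/asboolP; exists 0; rewrite mxrank0; split=> // u.
  by rewrite submx0 => /eqP ->.
have Pb r : P r -> (r <= m)%N by move=> /asboolP[A [_ <-]]; exact: rank_leq_row.
have [r /asboolP [A [AV rA]] rmax] := ex_maxnP P0 Pb.
exists A => u; split=> [Vu|]; last exact: AV.
apply: contrapT => /negP uA.
have : P (\rank (A + u)%MS).
  apply/asboolP; exists (A + u)%MS; split=> // v /sub_addsmxP [[a b] /= ->].
  rewrite addrC; have /sub_rVP [t ->] : (b *m u <= u)%MS by exact: submxMl.
  by apply: Vlin => //; apply: AV; exact: submxMl.
move=> /rmax; rewrite -rA leqNgt; case/negP; apply: rank_ltmx.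
rewrite ltmxE addsmxSl /=; apply: contra uA; apply: submx_trans.
exact: addsmxSr.
Qed.

Lemma row_separation (u : 'rV[K]_m) : ~ V u ->
  exists c : 'cV[K]_m, (forall v, V v -> v *m c = 0) /\ u *m c != 0.
Proof.
have [A AP] := rowspace_set; move=> nVu.
have : ~~ (u <= A)%MS by apply/negP => /AP.
rewrite submxE => /matrix0Pn [i [j uij]]; exists (col j (cokermx A)); split=> [v /AP|].
  by rewrite submxE colE mulmxA => /eqP ->; rewrite mul0mx.
apply/matrix0Pn; exists i, 0; rewrite colE mulmxA -colE mxE.
by rewrite (ord1 i) in uij *.
Qed.

End Separation.

Section Cofinite.
Variables (R : realType) (X : normedModType R).
Implicit Types (f g : dual X) (x y : X) (Y : set (dual X)).

(** A weak-star neighbourhood of f that misses Y tests finitely many points xs, so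
    the separation takes place among the values at xs; the separating vector gives
    a linear combination of the xs. *)
Lemma wstar_separation Y f : subspace_of_dual Y ->
  closed (Y : set (weak_star X)) -> ~ Y f ->
  exists x, (forall g, Y g -> g x = 0) /\ f x = 1.
Proof.
move=> [Y0 Ylin] Ycl nYf.
have : nbhs (f : weak_star X) (~` Y) by apply: open_nbhs_nbhs; split=> //; exact: closed_openC.
move=> /wstar_nbhsP [xs [e e0 nY]].
pose ev g : 'rV[R]_(size xs) := \row_i g xs`_i.
have evlin (a : R) g h : ev (a *: g + h) = a *: ev g + ev h.
  by apply/rowP => i; rewrite !mxE.
pose V := [set ev g | g in Y].
have [|||c [cV cf]] := @row_separation R (size xs) V _ _ (ev f).
- by exists 0 => //; apply/rowP => i; rewrite !mxE.
- by move=> a _ _ [g Yg <-] [h Yh <-]; exists (a *: g + h); [exact: Ylin|exact: evlin].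
- move=> [g Yg gf]; apply: (nY g) Yg => x /(nthP 0) [i ilt <-].
  have := congr1 (fun r : 'rV_(size xs) => r 0 (Ordinal ilt)) gf.
  by rewrite !mxE /= => ->; rewrite subrr normr0.
pose z := \sum_i c i 0 *: xs`_i.
have zE g : g z = (ev g *m c) 0 0.
  by rewrite dual_sum mxE; apply: eq_bigr => i _; rewrite dualZ mxE mulrC.
have fz : f z != 0.
  apply: contra cf => /eqP fz0; apply/eqP/matrixP => i j.
  by rewrite !ord1 -zE fz0 mxE.
exists ((f z)^-1 *: z); split=> [g Yg|]; last by rewrite dualZ mulVf.
by rewrite dualZ (zE g) (cV (ev g)) ?mxE ?mulr0 //; exists g.
Qed.

Definition biorthogonal Y k (x : 'I_k -> X) (e : 'I_k -> dual X) : Prop :=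
  (forall g i, Y g -> g (x i) = 0) /\ forall i j, e i (x j) = (i == j)%:R.

Lemma biorthogonal_extend Y k (x : 'I_k -> X) (e : 'I_k -> dual X) f y :
  biorthogonal Y x e -> (forall g, Y g -> g y = 0) ->
  (forall i, f (x i) = 0) -> f y = 1 ->
  exists (x' : 'I_k.+1 -> X) (e' : 'I_k.+1 -> dual X), biorthogonal Y x' e'.
Proof.
move=> [Yx ex] Yy fx fy.
exists (fun i => if unlift ord0 i is Some j then x j else y).
exists (fun i => if unlift ord0 i is Some j then e j - e j y *: f else f).
split=> [g i Yg|i j]; first by case: unliftP => [j _|_]; [exact: Yx|exact: Yy].
case: unliftP => [i' ->|->]; case: unliftP => [j' ->|->].
- by rewrite dualBE dualZE fx mulr0 subr0 ex (inj_eq lift_inj).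
- by rewrite dualBE dualZE fy mulr1 subrr eq_sym (negbTE (neq_lift _ _)).
- by rewrite fx (negbTE (neq_lift _ _)).
- by rewrite fy eqxx.
Qed.

(** Take a biorthogonal system of maximal size with points annihilated by Y. The
    sizes are bounded because the identity matrix e i (x j) factors through the
    finitely many functionals that span the dual modulo Y; by maximality and
    separation, what remains after the projection lies in Y. *)
Lemma cof_projection Y : cof_wstar X Y ->
  exists k (x : 'I_k -> X) (e : 'I_k -> dual X),
    forall f, Y (f - \sum_i f (x i) *: e i).
Proof.
move=> [Ysub Ycl [n [u uP]]]; have [Y0 Ylin] := Ysub.
pose P k := `[< exists (x : 'I_k -> X) (e : 'I_k -> dual X), biorthogonal Y x e >].
have P0 : exists k, P k.
  exists 0%N; apply/asboolP; exists (fun=> 0), (fun=> 0); split=> [? []|[]] //.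
have Pb k : P k -> (k <= n)%N.
  move=> /asboolP [x [e [Yx ex]]].
  have [a aP] := choice (fun i => uP (e i)).
  pose A := \matrix_(i < k, l < n) a i l.
  pose B := \matrix_(l < n, j < k) (u l (x j) : R).
  have AB : A *m B = 1%:M.
    apply/matrixP => i j; rewrite !mxE -ex; apply/esym.
    have := Yx _ j (aP i); rewrite dualBE dual_sumE => /eqP; rewrite subr_eq0 => /eqP ->.
    by apply: eq_bigr => l _; rewrite !mxE dualZE.
  by rewrite -[k](mxrank1 R) -AB (leq_trans (mxrankM_maxl _ _)) // rank_leq_col.
have [k /asboolP [x [e bi]] kmax] := ex_maxnP P0 Pb.
have [Yx ex] := bi.
exists k, x, e => f; apply: contrapT => nY.
have [y [Yy fy]] := wstar_separation Ysub Ycl nY.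
have [|x' [e' bi']] := biorthogonal_extend bi Yy _ fy.
  move=> j; rewrite dualBE dual_sumE (bigD1 j) // dualZE ex eqxx mulr1.
  rewrite big1 => [|i ij]; last by rewrite dualZE ex (negbTE ij) mulr0.
  by rewrite /= addr0 subrr.
have /kmax : P k.+1 by apply/asboolP; exists x', e'.
by rewrite ltnn.
Qed.

Lemma cof_setT : cof_wstar X [set: dual X].
Proof.
split; [by split|exact: (@closedT (weak_star X))|].
by exists 0%N, (fun=> 0) => f; exists (fun=> 0).
Qed.

Lemma cof_ker Y x : cof_wstar X Y -> cof_wstar X (Y `&` [set f | f x = 0]).
Proof.
move=> [[Y0 Ylin] Ycl [n [u uP]]]; split.
- split=> // a f g [Yf /= fx] [Yg /= gx]; split; first exact: Ylin.
  by change (a * f x + g x = 0); rewrite fx gx mulr0 addr0.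
- apply: closedI => //.
  move=> f fcl; apply/eqP; rewrite -normr_le0; apply/ler_addgt0Pr => e e0; rewrite add0r.
  have [|g [/= gx gf]] := fcl [set g | wnear [:: x] e f g].
    by apply/wstar_nbhsP; exists [:: x], e.
  by have := gf x (mem_head _ _); rewrite gx sub0r normrN => /ltW.
- have [[g [Yg gx]]|ng] := pselect (exists g, Y g /\ g x != 0).
    exists n.+1, (fun i => if unlift ord0 i is Some j then u j else g) => f.
    have [a aP] := uP f; set h := f - _ in aP.
    exists (fun i => if unlift ord0 i is Some j then a j else h x / g x).
    rewrite big_ord_recl unlift_none.
    under eq_bigr => i _ do rewrite liftK.
    rewrite opprD addrCA -/h; split.
      by rewrite -scaleNr; exact: Ylin.
    by change (- (h x / g x * g x) + h x = 0); rewrite divfK // addNr.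
  exists n, u => f; have [a aP] := uP f; exists a; split=> //=.
  by apply/eqP/negP => /negP hx; apply: ng; exists (f - \sum_(i < n) a i *: u i).
Qed.

Lemma cof_kers Y (F : seq X) : cof_wstar X Y ->
  cof_wstar X (Y `&` [set f | forall x, x \in F -> f x = 0]).
Proof.
move=> cY; elim: F => [|x F IH].
  by have -> // : Y `&` [set f : dual X | forall x, x \in [::] -> f x = 0] = Y; rewrite predeqE => f; split=> [[]|].
have -> : Y `&` [set f : dual X | forall y, y \in x :: F -> f y = 0] =
    (Y `&` [set f : dual X | forall y, y \in F -> f y = 0]) `&` [set f : dual X | f x = 0].
  rewrite predeqE => f; split=> [[Yf fF]|[[Yf fF] fx]].
    by split; [split=> // y yF|]; apply: fF; rewrite inE ?yF ?orbT ?eqxx.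
  by split=> // y; rewrite inE => /orP[/eqP -> //|]; exact: fF.
exact: cof_ker.
Qed.

(** * Finite nets and approximate kernels *)

(** Pigeonhole: the values of each g are cut into intervals of length e. *)
Lemma finite_net (gs : seq (dual X)) (c e : R) (S : set X) : 0 < e ->
  (forall z, S z -> `|z| <= c) ->
  exists F : seq X, (forall z, z \in F -> S z) /\
    forall z, S z -> exists2 z', z' \in F & forall g, g \in gs -> `|g (z - z')| <= e.
Proof.
move=> e0; elim: gs S => [|g gs IH] S Sc.
  have [[z Sz]|nS] := pselect (S !=set0).
    exists [:: z]; split=> [y|y Sy]; first by rewrite inE => /eqP ->.
    by exists z; rewrite ?mem_head.
  by exists [::]; split=> // z Sz; exfalso; apply: nS; exists z.
have [b b0 gb] := dual_bounded g.
(* the interval of length e that contains g z; the shift makes it nonnegative *)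
pose idx z := Num.truncn ((g z + b * c) / e).
have pos z : S z -> 0 <= (g z + b * c) / e.
  move=> Sz; apply: divr_ge0 (ltW e0); rewrite -lerBlDr sub0r.
  have : `|g z| <= b * c by apply: le_trans (gb z) _; rewrite ler_wpM2l // Sc.
  by rewrite ler_norml => /andP[].
have bnd z : S z -> (idx z < (Num.truncn ((b * c + b * c) / e)).+1)%N.
  move=> Sz; rewrite ltnS; apply: le_truncn; rewrite ler_pM2r ?invr_gt0 // lerD2r.
  have : `|g z| <= b * c by apply: le_trans (gb z) _; rewrite ler_wpM2l // Sc.
  by rewrite ler_norml => /andP[].
have [F FP] := choice (fun j => IH (S `&` [set z | idx z = j]) (fun z Sz => Sc z Sz.1)).
set K := (_.+1) in bnd.
exists (flatten [seq F j | j <- iota 0 K]); split.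
  move=> z /flattenP [_ /mapP [j _ ->]] zF.
  by have [/(_ z zF) [] ] := FP j.
move=> z Sz; have [_ /(_ z (conj Sz erefl)) [z' zF zP]] := FP (idx z).
exists z'.
  apply/flattenP; exists (F (idx z)) => //; apply/mapP; exists (idx z) => //.
  by rewrite mem_iota bnd.
have [/(_ z' zF) [Sz' /= iz'] _] := FP (idx z).
move=> h; rewrite inE => /orP[/eqP ->|]; last exact: zP.
have := truncn_itv (pos z Sz); have := truncn_itv (pos z' Sz').
rewrite -/(idx z) -/(idx z') iz' !ler_pdivlMr // !ltr_pdivrMr // => /andP[h1 h2] /andP[h3 h4].
rewrite dualB ler_norml.
move: h1 h2 h3 h4; rewrite -natr1 mulrDl mul1r => h1 h2 h3 h4.
by apply/andP; split; lra.
Qed.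

(** A substitute for a bounded projection onto the common kernel of gs: when g
    vanishes on a finite net of the ball, subtracting the net point near z makes
    every functional of gs small and does not change the value of g. *)
Lemma almost_kernel (gs : seq (dual X)) (c e : R) : 0 < e ->
  exists F : seq X, forall g : dual X, (forall z, z \in F -> g z = 0) ->
    forall z, `|z| <= c -> exists y, [/\ `|y| <= c + c, g y = g z
      & forall h, h \in gs -> `|h y| <= e].
Proof.
move=> e0; have [F [FS FP]] := @finite_net gs c e [set z | `|z| <= c] e0 (fun _ => id).
exists F => g gF z zc; have [z' z'F hz] := FP z zc.
exists (z - z'); split=> //; last by rewrite dualB (gF _ z'F); exact: subr0.
by apply: le_trans (ler_normB _ _) _; rewrite lerD //; exact: (FS z').
Qed.

End Cofinite.

(** Arithmetic tactics compare atoms up to conversion; replacing the dual norms by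
    variables keeps them from unfolding suprema. *)
Ltac abstract_norms :=
  repeat match goal with H : context [dual_norm ?N ?f] |- _ => revert H end;
  repeat match goal with |- context [dual_norm ?N ?f] =>
    generalize (dual_norm N f); intro end;
  intros.
Ltac norm_lra := abstract_norms; lra.
Ltac norm_nra := abstract_norms; nra.

(** * Asymptotic uniform convexity *)

Section AUC.
Variables (R : realType) (X : normedModType R).
Implicit Types (M : dual X -> R) (f g : dual X).

(** The extended infimum and supremum, replaced by one real delta that serves all
    x. *)
Lemma auc_starP M (t : R) : auc_star M -> 0 < t ->
  exists2 delta : R, 0 < delta & forall x, M x = 1 ->
    exists Y, cof_wstar X Y /\
      forall y, Y y -> M y = 1 -> 1 + delta <= M (x + t *: y).
Proof.
move=> auc t0; have := auc t t0; set I := ereal_inf _ => I0.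
have [d d0 dI] : exists2 d : R, 0 < d & (d%:E < I)%E.
  move: I0; case: I => [r| |] //; last by exists 1; rewrite ?ltry.
  by rewrite lte_fin => r0; exists (r / 2); rewrite ?lte_fin; lra.
exists d => // x Mx.
have /(lt_le_trans dI) : (I <= ereal_sup [set
             ereal_inf [set (M (x + t *: y) - 1)%:E
                       | y in Y `&` unit_sphere M]
           | Y in cof_wstar X])%E by apply: ereal_inf_lbound; exists x.
move=> /ereal_sup_gt [_ [Y cY <-] dY]; exists Y; split=> // y Yy My.
have : (d%:E < (M (x + t *: y) - 1)%:E)%E.
  by apply: lt_le_trans dY _; apply: ereal_inf_lbound; exists y.
by rewrite lte_fin; lra.
Qed.

Lemma auc_star_intro M :
  (forall t : R, 0 < t -> exists2 delta : R, 0 < delta & forall x, M x = 1 ->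
    exists Y, cof_wstar X Y /\
      forall y, Y y -> M y = 1 -> 1 + delta <= M (x + t *: y)) ->
  auc_star M.
Proof.
move=> h t t0; have [d d0 dP] := h t t0.
apply: (@lt_le_trans _ _ d%:E); first by rewrite lte_fin.
apply: le_ereal_inf_tmp => _ [x Mx <-]; have [Y [cY YP]] := dP x Mx.
apply: le_trans (ereal_sup_ubound _); last by exists Y.
apply: le_ereal_inf_tmp => _ [y [Yy My] <-].
by rewrite lee_fin; have := YP y Yy My; lra.
Qed.

Variable N : X -> R.
Hypothesis HN : equivalent_norm N.
Local Notation M := (dual_norm N).

(** Convexity of s |-> M (x + s y). *)
Lemma auc_further (x y : dual X) (t s d : R) : M x = 1 -> 0 < t -> t <= s ->
  0 <= d -> 1 + d <= M (x + t *: y) -> 1 + d <= M (x + s *: y).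
Proof.
move=> Mx t0 ts d0 h; have s0 : 0 < s by exact: lt_le_trans ts.
have E : x + t *: y = (t / s) *: (x + s *: y) + (1 - t / s) *: x.
  by rewrite scalerDr scalerA divfK ?gt_eqF // addrAC -scalerDl [t / s + _]addrC subrK scale1r.
have ts1 : t / s <= 1 by rewrite ler_pdivrMr // mul1r.
have r0 : 0 < t / s by rewrite divr_gt0.
move: h; rewrite E => h; have := le_trans h (dual_normD HN _ _).
rewrite !(dual_normZ HN) (gtr0_norm r0) ger0_norm ?subr_ge0 // Mx mulr1 => h2.
have {h2} h3 : d <= t / s * (M (x + s *: y) - 1) by lra.
have : d <= M (x + s *: y) - 1; last by lra.
rewrite leNgt; apply/negP => lt.
have [p|p] := leP 0 (M (x + s *: y) - 1); last by nra.
by have := ler_wpM2r p ts1; rewrite mul1r; lra.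
Qed.

Lemma dual_norm_cluster (w : nat -> dual X) f p (c : R) : 0 <= c ->
  (forall xs e n, 0 < e -> exists2 i, (n <= i)%N & wnear xs e f (w i)) ->
  (forall i, M (w i - p) <= c) -> M (f - p) <= c.
Proof.
move=> c0 fcl wp; apply: (dual_norm_le HN) => // x.
apply/ler_addgt0Pr => e e0.
have [i _ wi] := fcl [:: x] e 0%N e0; have := wi x (mem_head _ _).
have := dual_norm_ub HN (w i - p) x; rewrite !dualBE => h1 h2.
have h3 : M (w i - p) * N x <= c * N x by rewrite ler_wpM2r // eqnorm_ge0.
have E (r s t : R) : r - s = (t - s) - (t - r) by ring.
rewrite (E (f x) (p x) (w i x)).
by apply: le_trans (ler_normB _ _) _; lra.
Qed.

(** Subtract the projection given by cof_projection. *)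
Lemma cof_approx Y (e : R) : cof_wstar X Y -> 0 < e ->
  exists xs : seq X, exists2 r : R, 0 < r & forall z : dual X,
    (forall x, x \in xs -> `|z x| < r) -> exists2 z', Y z' & M (z - z') <= e.
Proof.
move=> cY e0; have [k [x [u uP]]] := cof_projection cY.
pose S := \sum_i M (u i); have S0 : 0 <= S by apply: sumr_ge0 => i _; exact: dual_norm_ge0.
exists (map x (enum 'I_k)); exists (e / (S + 1)); first by rewrite divr_gt0 // ltr_wpDl.
move=> z zx; exists (z - \sum_i z (x i) *: u i); first exact: uP.
rewrite opprB addrC subrK; apply: le_trans (dual_norm_sum HN _ _ _) _.
apply: (@le_trans _ _ (\sum_i e / (S + 1) * M (u i))).
  apply: ler_sum => i _; rewrite (dual_normZ HN) ler_wpM2r ?dual_norm_ge0 // ltW //.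
  by apply: zx; apply: map_f; rewrite mem_enum.
rewrite -mulr_sumr -/S mulrAC ler_pdivrMr ?ltr_wpDl // ler_wpM2l ?ltW //; lra.
Qed.

(** Let f be a weak-star cluster point of w. Some w k is weak-star close to f but
    at distance at least sigma / 2 from it. If M (f - p) were close to 1, the AUC
    property at f - p in the direction w k - f would make M (w k - p) larger
    than 1. Hence M (f - p) <= 1 - eta, while M (q - f) <= b by weak-star lower
    semicontinuity. *)
Lemma auc_contract (sigma b : R) : auc_star M -> 0 < sigma ->
  exists eta : R, [/\ 0 < eta, eta <= 1 / 2 &
    forall (p q : dual X) (w : nat -> dual X),
      (forall i, M (w i - p) <= 1) -> (forall i, M (q - w i) <= b) ->
      (forall i j, i <> j -> sigma <= M (w i - w j)) ->
      M (q - p) <= 1 + b - eta].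
Proof.
move=> auc s0; have t0 : 0 < sigma / 4 by lra.
have [d' d'0 dP'] := auc_starP auc t0.
(* With d <= 1 the product (1 + d) * (1 - d / 4) still exceeds 1 + d / 4. *)
pose d := Num.min d' 1.
have d0 : 0 < d by rewrite lt_min d'0 ltr01.
have d1 : d <= 1 by rewrite ge_min lexx orbT.
have dd' : d <= d' by rewrite ge_min lexx.
pose mu := Num.min (sigma / 4) (d / 4).
have mu0 : 0 < mu by rewrite lt_min t0; lra.
have mus : mu <= sigma / 4 by rewrite ge_min lexx.
have mud : mu <= d / 4 by rewrite ge_min lexx orbT.
exists (d / 4); split; [lra|lra|] => p q w wp wq wsep.
have b0 : 0 <= b by apply: le_trans (wq 0%N); exact: dual_norm_ge0.
have [_ _ _ [a0 [b1 [a0_gt0 b1_gt0 Nb]]]] := HN.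
have wb i x : `|w i x| <= (1 + M p) * b1 * `|x|.
  apply: le_trans (dual_norm_ub HN _ _) _; rewrite -mulrA.
  apply: ler_pM; [exact: dual_norm_ge0|exact: eqnorm_ge0| |by have [_] := Nb x].
  by apply: le_trans (dual_norm_tri HN _ p) _; rewrite lerD2r.
have [f [_ fcl]] := wstar_ball_cluster wb.
have Mu := dual_norm_cluster ler01 fcl wp.
have Mv : M (f - q) <= b.
  by apply: (dual_norm_cluster b0 fcl) => i; rewrite dual_norm_distC.
have tri : M (q - p) <= M (f - q) + M (f - p).
  rewrite [M (f - q)](dual_norm_distC HN); have -> : q - p = (q - f) + (f - p) by rewrite addrA subrK.
  exact: dual_normD.
suff : M (f - p) <= 1 - d / 4 by norm_lra.
rewrite leNgt; apply/negP => Mu'.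
have [u uE] : exists u, u = f - p by exists (f - p).
rewrite -uE in Mu Mu' tri.
have Mu0 : 0 < M u by norm_lra.
have u0 : u != 0 by apply/eqP => e; rewrite e (dual_norm0 HN) ltxx in Mu0.
have [Y [cY YP]] := dP' _ (dual_norm_normalize HN u0).
have [xs [r r0 approx]] := cof_approx cY mu0.
have [i _ wi] := fcl xs r 0%N r0.
have [j ij wj] := fcl xs r i.+1 r0.
have [k wk zk] : exists2 k, wnear xs r f (w k) & sigma / 2 <= M (w k - f).
  have [zi|/negP] := pselect (sigma / 2 <= M (w i - f)).
    by exists i; [exact: wi|exact: zi].
  rewrite -ltNge => zi.
  exists j; first exact: wj.
  have : sigma <= M (w i - w j) by apply: wsep => e; rewrite e ltnn in ij.
  have -> : w i - w j = (w i - f) - (w j - f) by rewrite opprB addrA subrK.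
  by move=> /le_trans /(_ (dual_normD HN _ _)); rewrite (dual_normN HN); norm_lra.
have [z' Yz' zz'] := approx (w k - f) wk.
have Mz' : sigma / 4 <= M z'.
  have := dual_norm_tri HN (w k - f) z'; norm_lra.
have z'0 : z' != 0 by apply/eqP => e; rewrite e (dual_norm0 HN) in Mz'; norm_lra.
have Mz'0 : 0 < M z' by norm_lra.
pose y := (M z')^-1 *: z'.
have Yy : Y y.
  by have [[Y0 Ylin] _ _] := cY; have := Ylin (M z')^-1 _ _ Yz' Y0; rewrite addr0.
have := YP _ Yy (dual_norm_normalize HN z'0) => far.
have ts : sigma / 4 <= M z' / M u.
  by rewrite ler_pdivlMr //; apply: le_trans Mz'; rewrite ler_piMr // ltW.
have {far} far : 1 + d <= M ((M u)^-1 *: u + (M z' / M u) *: y).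
  apply: (auc_further (dual_norm_normalize HN u0) t0 ts (ltW d0)).
  by apply: le_trans far; rewrite lerD2l.
have E : (M u)^-1 *: u + (M z' / M u) *: y = (M u)^-1 *: (u + z').
  by rewrite /y scalerA mulrAC divff ?gt_eqF // mul1r scalerDr.
move: far; rewrite E (dual_normZ HN) gtr0_norm ?invr_gt0 // mulrC ler_pdivlMr // => far.
have : M (u + z') <= M (w k - p) + M (w k - f - z').
  have -> : u + z' = (w k - p) - (w k - f - z').
    by rewrite uE !opprB [RHS]addrC -!addrA addKr [RHS]addrC -addrA.
  by apply: le_trans (dual_normD HN _ _) _; rewrite (dual_normN HN).
have := wp k; norm_nra.
Qed.

End AUC.

(** * Displacement between the ends of a graph *)

Section Displacement.
Variables (R : realType) (X : normedModType R) (N : X -> R).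
Hypothesis HN : equivalent_norm N.
Local Notation M := (dual_norm N).

Definition lipschitz_nat (G : tb_graph) (g : vertex G -> nat) : Prop :=
  forall u v, tb_arc u v -> (ndist (g u) (g v) <= 1)%N.

(** The separation is tested by Lipschitz functions with equal values at the two
    ends instead of the graph distance: such functions extend from one copy of H
    to the whole of slash G H, so the condition restricts to the copies. *)
Definition separated_map (sigma : R) (G : tb_graph) (f : vertex G -> dual X) :
    Prop :=
  (forall u v, tb_arc u v -> M (f v - f u) <= 1) /\
  forall g : vertex G -> nat, lipschitz_nat g ->
    g (tb_bottom G) = g (tb_top G) ->
    forall x y, sigma * (ndist (g x) (g y))%:R <= M (f x - f y).

Definition displacement (sigma : R) (G : tb_graph) (D : R) : Prop :=
  forall f : vertex G -> dual X, separated_map sigma f ->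
    M (f (tb_top G) - f (tb_bottom G)) <= D.

Lemma upwalk_displacement (G : tb_graph) (f : vertex G -> dual X) (D : R) n
    (u v : vertex G) : (forall u v, tb_arc u v -> M (f v - f u) <= D) ->
  upwalk n u v -> M (f v - f u) <= n%:R * D.
Proof.
move=> fD; elim: n u => [u ->|n IH u [w [/fD uw /IH wv]]].
  by rewrite subrr (dual_norm0 HN) mul0r.
have -> : f v - f u = (f v - f w) + (f w - f u) by rewrite addrA subrK.
apply: le_trans (dual_normD HN _ _) _; rewrite -natr1 mulrDl mul1r.
exact: lerD.
Qed.

Lemma displacement_trivial sigma (G : tb_graph) h ht :
  grading (G := G) h ht -> displacement sigma G h%:R.
Proof.
move=> [hb _ _ hw] f [f1 _]; have [_ _] := hw (tb_bottom G).
by rewrite hb subn0 -[X in _ <= X]mulr1; exact: upwalk_displacement.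
Qed.

Lemma grading_upwalk (G : tb_graph) h ht n (u v : vertex G) :
  grading (G := G) h ht -> upwalk n u v -> (ht v = ht u + n)%N.
Proof.
move=> [_ _ ha _]; elim: n u => [u ->|n IH u [w [/ha uw /IH ->]]].
  by rewrite addn0.
by rewrite uw addnS.
Qed.

Section Copies.
Variables (G H : tb_graph) (sigma : R).
Variable f : vertex (slash G H) -> dual X.
Hypothesis fsep : separated_map sigma f.
Local Notation cls := (glue_class (slash_id (G := G) (H := H))).

(** Outside the copy, extend g by its common value at the two ends. *)
Lemma separated_copy (e : arcs G) :
  separated_map sigma (fun u => f (cls (inr (e, u)))).
Proof.
have [f1 f2] := fsep; split=> [u v uv|g glip gbt x y].
  by apply: f1; exact: slash_arcs.
pose ge (e' : arcs G) u := if `[< e' = e >] then g u else g (tb_bottom H).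
have [El Er] : _ /\ _ := @slash_liftE G H _ (fun=> g (tb_bottom H)) ge
  ltac:(by move=> e'; rewrite /ge; case: ifP)
  ltac:(by move=> e'; rewrite /ge -gbt; case: ifP).
have gee u : ge e u = g u by rewrite /ge; case: asboolP.
have := f2 (slash_lift (fun=> g (tb_bottom H)) ge) _ _ (cls (inr (e, x))) (cls (inr (e, y))).
rewrite !Er !gee; apply; last by rewrite /= !El.
apply: slash_arc_ind => e' u v uv; rewrite !Er /ge; case: ifP => _; first exact: glip.
by rewrite /ndist subnn.
Qed.

(** The test function is the distance to w truncated at hH; it takes the value hH
    at both ends because w lies strictly between them. *)
Lemma separated_vertices h ht hH htH (w w' : vertex G) :
  grading (G := G) h ht -> grading (G := H) hH htH ->
  (0 < ht w < h)%N -> w <> w' ->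
  sigma * hH%:R <= M (f (cls (inl w)) - f (cls (inl w'))).
Proof.
move=> [hb hh ha _] [Hb Hh Ha Hw] /andP[w0 wh] ww'.
have [_ f2] := fsep.
pose gl v := if `[< v = w >] then 0%N else hH.
pose gr (e : arcs G) u := if `[< (proj1_sig e).1 = w >] then htH u
  else if `[< (proj1_sig e).2 = w >] then (hH - htH u)%N else hH.
have [El Er] : _ /\ _ := @slash_liftE G H _ gl gr
  ltac:(by move=> e; rewrite /gl /gr Hb subn0; case: ifP => // _; case: ifP)
  ltac:(move=> [[p q] pq]; rewrite /gl /gr Hh subnn /=; case: asboolP => [pw|//];
        case: asboolP => [qw|//]; by have := ha _ _ pq; rewrite /= pw qw => /n_Sn).
have glw : gl w = 0%N by rewrite /gl; case: asboolP.
have glw' : gl w' = hH by rewrite /gl; case: asboolP => // /esym.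
have glb : gl (tb_bottom G) = hH.
  by rewrite /gl; case: asboolP => // e; rewrite -e hb in w0.
have glt : gl (tb_top G) = hH.
  by rewrite /gl; case: asboolP => // e; rewrite -e hh ltnn in wh.
have := f2 (slash_lift gl gr) _ _ (cls (inl w)) (cls (inl w')).
rewrite !El glw glw' /ndist sub0n subn0 add0n; apply.
  apply: slash_arc_ind => e u v uv; rewrite !Er /gr; have := Ha _ _ uv.
  by case: ifP => _; [|case: ifP => _]; rewrite /ndist; lia.
by rewrite ?El glb glt.
Qed.

End Copies.

(** By separated_copy, the ends of an edge of G are mapped at most D apart. In
    units of l1 * D the spider is then a configuration for the contraction
    hypothesis, which saves l1 * eta * D on the way from p to q. *)
Lemma displacement_slash (sigma D eta : R) (G H : tb_graph) k1 l1 l2 k2 h ht hH htH :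
  spider G k1 l1 l2 k2 -> grading (G := G) h ht -> grading (G := H) hH htH ->
  0 < sigma -> 0 < D -> D <= hH%:R ->
  (forall (p q : dual X) (w : nat -> dual X),
      (forall i, M (w i - p) <= 1) -> (forall i, M (q - w i) <= l2%:R / l1%:R) ->
      (forall i j, i <> j -> sigma / l1%:R <= M (w i - w j)) ->
      M (q - p) <= 1 + l2%:R / l1%:R - eta) ->
  displacement sigma H D ->
  displacement sigma (slash G H) ((h%:R - l1%:R * eta) * D).
Proof.
move=> [p [q [w [[l10 l20] bp qt wP winj]]]] gG gH s0 D0 DH contr dH f fsep.
pose F v := f (glue_class (slash_id (G := G) (H := H)) (inl v)).
have FD u v : tb_arc u v -> M (F v - F u) <= D.
  move=> uv; pose e : arcs G := exist _ (u, v) uv.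
  have := dH _ (separated_copy fsep e).
  by rewrite slash_bottom slash_top.
have l1R : 0 < l1%:R :> R by rewrite ltr0n.
pose la : R := l1%:R * D; have la0 : 0 < la by rewrite mulr_gt0.
have [hb hh _ _] := gG.
have hp := grading_upwalk gG bp; have hq := grading_upwalk gG qt.
have hw i : ht (w i) = (ht p + l1)%N by apply: grading_upwalk gG (wP i).1.
have hwq i : ht q = (ht (w i) + l2)%N by apply: grading_upwalk gG (wP i).2.
have hsum : h = (k1 + (l1 + l2) + k2)%N.
  by have := hw 0%N; have := hwq 0%N; rewrite -hh; lia.
have scale (v v' : dual X) : M (la^-1 *: v - la^-1 *: v') = M (v - v') / la.
  by rewrite -scalerBr (dual_normZ HN) gtr0_norm ?invr_gt0 // mulrC.
have Mqp : M (F q - F p) <= (1 + l2%:R / l1%:R - eta) * la.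
  rewrite -ler_pdivrMr // -scale.
  apply: (contr _ _ (fun i => la^-1 *: F (w i))) => [i|i|i j ij].
  - rewrite scale ler_pdivrMr // mul1r.
    exact: upwalk_displacement FD (wP i).1.
  - rewrite scale ler_pdivrMr //.
    have -> : l2%:R / l1%:R * la = l2%:R * D by rewrite /la mulrA divfK ?gt_eqF.
    exact: upwalk_displacement FD (wP i).2.
  - rewrite scale ler_pdivlMr //.
    have -> : sigma / l1%:R * la = sigma * D by rewrite /la mulrA divfK ?gt_eqF.
    apply: (@le_trans _ _ (sigma * hH%:R)); first by rewrite ler_pM2l.
    apply: separated_vertices fsep _ _ _ _ _ _ gG gH _ _.
      by have := hwq i; have := hw i; lia.
    by move=> /winj.
have Mbp := upwalk_displacement FD bp.
have Mqt := upwalk_displacement FD qt.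
have -> : f (tb_top (slash G H)) - f (tb_bottom (slash G H)) =
    (F (tb_top G) - F q) + ((F q - F p) + (F p - F (tb_bottom G))).
  by rewrite !addrA !subrK.
apply: le_trans (dual_normD HN _ _) _.
apply: le_trans (lerD (lexx _) (dual_normD HN _ _)) _.
have E : (1 + l2%:R / l1%:R - eta) * la = (l1%:R + l2%:R) * D - l1%:R * eta * D.
  by rewrite /la; field; rewrite gt_eqF.
rewrite E in Mqp; rewrite hsum !natrD.
apply: le_trans (lerD Mqt (lerD Mqp Mbp)) _.
by rewrite le_eqVlt; apply/orP; left; apply/eqP; ring.
Qed.

End Displacement.

(** * Asymptotic uniform convexity excludes the bundle graphs *)

Lemma lipschitz_nat_walk (G : tb_graph) (g : vertex G -> nat) n (u v : vertex G) :
  lipschitz_nat g -> walk n u v -> (ndist (g u) (g v) <= n)%N.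
Proof.
move=> glip; elim: n u => [u ->|n IH u [w [uw /IH wv]]]; first by rewrite /ndist subnn.
have : (ndist (g u) (g w) <= 1)%N.
  by case: uw => /glip //; rewrite /ndist addnC.
by move: wv; rewrite /ndist; lia.
Qed.

Lemma grading_lipschitz (G : tb_graph) h ht :
  grading (G := G) h ht -> lipschitz_nat ht.
Proof. by move=> [_ _ ha _] u v /ha; rewrite /ndist; lia. Qed.

Lemma grading_connected (G : tb_graph) h ht (u v : vertex G) :
  grading (G := G) h ht -> exists n, walk n u v.
Proof.
move=> [_ _ _ w]; exists (ht u + ht v)%N.
have [_ /upwalk_walk bu _] := w u; have [_ /upwalk_walk bv _] := w v.
exact: walk_cat (walk_sym bu) bv.
Qed.

(** Rescaled maps with distortion D are separated with a constant sigma that does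
    not depend on n. Iterating displacement_slash bounds the displacement of the
    ends by kap ^+ n times the height, with kap < 1, whereas the lower Lipschitz
    estimate bounds it from below by sigma times the height. *)
Lemma auc_star_not_embeds (R : realType) (X : normedModType R) (G : tb_graph)
    (N : X -> R) : equivalent_norm N -> auc_star (dual_norm N) ->
  nontrivial_bundle_graph G -> ~ equi_lipschitz_embeds X (slash_pow G).
Proof.
move=> HN auc [s [nt sG]] [D [f [sc [D1 emb]]]].
have [k1 [l1 [l2 [k2 sp]]]] := spider_nontrivial nt sG.
have [_ [ht [_ [gG _ _ _ _ _ _]]]] := codable_slash_pow 0 sG.
move: gG; rewrite expn1; set h := fheight s => gG.
have [_ _ _ [a [b [a0 b0 Nab]]]] := HN.
have D0 : 0 < D by exact: lt_le_trans ltr01 D1.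
pose sigma := a / (b * D).
have s0 : 0 < sigma by rewrite divr_gt0 // mulr_gt0.
have [p [q [w [[l10 l20] bp qt wP _]]]] := sp.
have l1R : 0 < l1%:R :> R by rewrite ltr0n.
have hl1 : (l1 < h)%N.
  have [hb hh _ _] := gG; have := grading_upwalk gG bp.
  have := grading_upwalk gG qt; have := grading_upwalk gG (wP 0%N).1.
  by have := grading_upwalk gG (wP 0%N).2; rewrite hb hh; lia.
have h0 : 0 < h%:R :> R by rewrite ltr0n; lia.
have sl : 0 < sigma / l1%:R by rewrite divr_gt0.
have [eta [eta0 eta1 contr]] := auc_contract HN (l2%:R / l1%:R) auc sl.
pose kap := 1 - l1%:R * eta / h%:R.
have le1 : l1%:R * eta < h%:R.
  have : (l1%:R : R) < h%:R by rewrite ltr_nat.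
  by nra.
have kap0 : 0 < kap by rewrite subr_gt0 ltr_pdivrMr // mul1r.
have kap1 : kap < 1 by rewrite gtrBl divr_gt0 // mulr_gt0.
have grad n : exists ht', grading (G := slash_pow G n.+1) (h ^ n.+1) ht'.
  by have [_ [ht' [_ [g _ _ _ _ _ _]]]] := codable_slash_pow n sG; exists ht'.
have disp n : displacement N sigma (slash_pow G n.+1) ((h ^ n.+1)%:R * kap ^+ n).
  elim: n => [|n IH].
    rewrite expr0 mulr1; have [ht' g] := grad 0%N.
    exact: displacement_trivial g.
  have -> : (h ^ n.+2)%:R * kap ^+ n.+1 =
      (h%:R - l1%:R * eta) * ((h ^ n.+1)%:R * kap ^+ n).
    have -> : h%:R - l1%:R * eta = h%:R * kap.
      by rewrite /kap; field; rewrite gt_eqF.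
    by rewrite expnS natrM exprS; ring.
  have [htH gH] := grad n.
  apply: (displacement_slash HN sp gG gH) => //.
  - by rewrite mulr_gt0 ?exprn_gt0 // natrX exprn_gt0.
  - by rewrite ler_piMr // exprn_ile1 // ltW.
have lower n : sigma <= kap ^+ n.
  have [sn0 snP] := emb n.+1 isT; set K := slash_pow G n.+1 in snP.
  pose c := a / (sc n.+1 * D); have c0 : 0 < c by rewrite divr_gt0 // mulr_gt0.
  pose F u := c *: f n.+1 u.
  have [ht' gK] := grad n; have [hb hh ha _] := gK.
  have FE u v : dual_norm N (F u - F v) = c * dual_norm N (f n.+1 u - f n.+1 v).
    by rewrite -scalerBr (dual_normZ HN) gtr0_norm.
  have O0 (g : dual X) : 0 <= original_dual_norm g.
    exact: dual_norm_ge0 (equivalent_norm_id X) g.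
  have up (g : dual X) : dual_norm N g <= original_dual_norm g / a.
    apply: (dual_norm_le HN) => [|x].
      exact: divr_ge0 (O0 g) (ltW a0).
    apply: le_trans (dual_norm_ub (equivalent_norm_id X) g x) _.
    rewrite -mulrA; apply: ler_wpM2l (O0 g) _ _ _.
    by rewrite ler_pdivlMl //; have [] := Nab x.
  have low (g : dual X) : original_dual_norm g / b <= dual_norm N g.
    rewrite ler_pdivrMr //; apply: (dual_norm_le (equivalent_norm_id X)) => [|x].
      exact: mulr_ge0 (dual_norm_ge0 HN g) (ltW b0).
    apply: le_trans (dual_norm_ub HN g x) _.
    by rewrite -mulrA ler_wpM2l ?dual_norm_ge0 //; have [] := Nab x.
  have lowF (u v : vertex K) : sigma * (graph_dist u v)%:R <= dual_norm N (F u - F v).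
    rewrite FE; have [sd _] := snP u v.
    apply: (@le_trans _ _ (c * (sc n.+1 * (graph_dist u v)%:R / b))).
      rewrite le_eqVlt; apply/orP; left; apply/eqP; rewrite /sigma /c; field.
      by rewrite !gt_eqF.
    rewrite ler_pM2l //; apply: le_trans (low _).
    by rewrite ler_pM2r ?invr_gt0.
  have Flip u v : tb_arc u v -> dual_norm N (F v - F u) <= 1.
    move=> uv; rewrite FE; have [_ sd] := snP v u.
    have gd1 : (graph_dist v u <= 1)%N.
      have wvu : walk 1 v u by exists u; split=> //; right.
      by have [] := graph_distP wvu.
    apply: (@le_trans _ _ (c * (sc n.+1 * D / a))).
      rewrite ler_pM2l //; apply: le_trans (up _) _; rewrite ler_pM2r ?invr_gt0 //.
      apply: le_trans sd _; rewrite ler_piMr ?(ltW (mulr_gt0 sn0 D0)) //.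
      by rewrite (ler_nat _ _ 1).
    rewrite le_eqVlt; apply/orP; left; apply/eqP; rewrite /c; field.
    by rewrite !gt_eqF.
  have natlow (g : vertex K -> nat) u v : lipschitz_nat g ->
      sigma * (ndist (g u) (g v))%:R <= dual_norm N (F u - F v).
    move=> glip; apply: le_trans (lowF u v); rewrite ler_pM2l // ler_nat.
    have [m wm] := grading_connected u v gK; have [wd _] := graph_distP wm.
    exact: lipschitz_nat_walk glip wd.
  have Fsep : separated_map N sigma F by split=> // g glip _ u v; exact: natlow.
  have := disp n _ Fsep.
  have htlip := grading_lipschitz gK.
  move=> /(le_trans (natlow ht' (tb_top K) (tb_bottom K) htlip)).
  rewrite hb hh /ndist subn0 sub0n addn0 mulrC ler_pM2l //.
  by rewrite natrX exprn_gt0.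
have /cvgrPdist_lt /(_ sigma s0) : kap ^+ n @[n --> \oo] --> (0 : R).
  by apply: cvg_expr; rewrite gtr0_norm.
move=> [n _ /(_ n (leqnn n))]; rewrite /= sub0r normrN gtr0_norm ?exprn_gt0 //.
by rewrite ltNge lower.
Qed.

(** * Szlenk derivations *)

Section Szlenk.
Variables (R : realType) (X : normedModType R).
Implicit Types (f g : dual X) (K : set (dual X)) (e : R).
Local Notation O := (@original_dual_norm R X).

Definition dual_ball : set (dual X) := [set f | forall x, `|f x| <= `|x|].

(** A Szlenk derivation. Asking for two distant points near f, rather than for one
    point far from f, makes the complement weak-star open. *)
Definition derived e K : set (dual X) :=
  [set f | forall xs r, 0 < r -> exists g g',
     [/\ K g, K g', wnear xs r f g, wnear xs r f g' & e <= O (g - g')]].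

Fixpoint szlenk e n : set (dual X) :=
  if n is m.+1 then derived e (szlenk e m) else dual_ball.

Lemma szlenkS e n : szlenk e n.+1 `<=` szlenk e n.
Proof.
elim: n => [|n IH] f /= fK.
  move=> x; apply/ler_addgt0Pr => r r0.
  have [g [_ [gb _ /(_ x (mem_head _ _)) gf _ _]]] := fK [:: x] r r0.
  have E (a b : R) : a = b - (b - a) by ring.
  by rewrite (E (f x) (g x)); exact: le_trans (ler_normB _ _) (lerD (gb x) (ltW gf)).
move=> xs r r0; have [g [g' [gK gK' ? ? ?]]] := fK xs r r0.
by exists g, g'; split=> //; exact: IH.
Qed.

Lemma szlenk_le e m n : (m <= n)%N -> szlenk e n `<=` szlenk e m.
Proof.
move=> /subnK <-; elim: (n - m)%N => // d IH.
by rewrite addSn; apply: subset_trans IH; exact: szlenkS.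
Qed.

Lemma wnear_tri xs e e' f g h : wnear xs e f g -> wnear xs e' g h ->
  wnear xs (e + e') f h.
Proof.
move=> fg gh x xs'; have E (a b c : R) : a - c = (b - c) + (a - b) by ring.
by rewrite (E (h x) (g x)); apply: le_lt_trans (ler_normD _ _) _; rewrite ltrD ?fg ?gh.
Qed.

Lemma wnear_le xs xs' e e' f g : {subset xs <= xs'} -> e' <= e ->
  wnear xs' e' f g -> wnear xs e f g.
Proof. by move=> sub ee h x /sub /h /lt_le_trans; apply. Qed.

Lemma wnear_refl xs e f : 0 < e -> wnear xs e f f.
Proof. by move=> e0 x _; rewrite subrr normr0. Qed.

Lemma wnear_join f (xs : nat -> seq X) (e : nat -> R) m :
  (forall k, 0 < e k) -> exists ys : seq X, exists2 r : R, 0 < r &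
    forall k g, (k < m)%N -> wnear ys r f g -> wnear (xs k) (e k) f g.
Proof.
move=> e0; elim: m => [|m [ys [r r0 IH]]]; first by exists [::], 1.
exists (xs m ++ ys), (Num.min (e m) r); first by rewrite lt_min e0.
move=> k g; rewrite ltnS leq_eqVlt => /orP[/eqP ->|km] gn.
  apply: wnear_le gn; first by move=> x xm; rewrite mem_cat xm.
  by rewrite ge_min lexx.
apply: IH km _; apply: wnear_le gn; first by move=> x xm; rewrite mem_cat xm orbT.
by rewrite ge_min lexx orbT.
Qed.

Lemma not_derived e K f : ~ derived e K f -> exists xs : seq X, exists2 r : R, 0 < r &
  forall g g', K g -> K g' -> wnear xs r f g -> wnear xs r f g' -> O (g - g') < e.
Proof.
move=> nf; apply: contrapT => h; apply: nf => xs r r0.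
apply: contrapT => h'; apply: h; exists xs, r => // g g' gK gK' gn gn'.
by rewrite ltNge; apply/negP => eg; apply: h'; exists g, g'.
Qed.

(** * The renorming *)

Variable depth : nat -> nat.
Definition mesh (k : nat) : R := (1 / 2) ^+ k.
Hypothesis depthP : forall k f, ~ szlenk (mesh k) (depth k) f.

(** At most depth k derivations by mesh k are survived, so the term k contributes at
    most (1 / 2) ^+ k.+1 to the score. *)
Definition weight (k : nat) : R := (1 / 2) ^+ k.+1 / (depth k).+1%:R.

Definition admissible g (j : nat -> nat) : Prop :=
  forall k, szlenk (mesh k) (j k) g.

Definition score (m : nat) (j : nat -> nat) : R :=
  \sum_(k < m) weight k * (j k)%:R.

Lemma weight_gt0 k : 0 < weight k.
Proof. by rewrite divr_gt0 // exprn_gt0 //; lra. Qed.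

Lemma admissible_depth g j k : admissible g j -> (j k < depth k)%N.
Proof.
move=> gj; rewrite ltnNge; apply/negP => sj.
exact: depthP (szlenk_le sj (gj k)).
Qed.

Lemma admissible_ball g j : admissible g j -> dual_ball g.
Proof. by move=> gj; exact: szlenk_le (leq0n _) _ (gj 0%N). Qed.

Lemma scoreS m j : score m.+1 j = score m j + weight m * (j m)%:R.
Proof. by rewrite /score big_ord_recr. Qed.

Lemma score_le m m' j : (m <= m')%N -> score m j <= score m' j.
Proof.
move=> /subnK <-; elim: (m' - m)%N => // d IH.
by rewrite addSn scoreS; apply: le_trans IH _; rewrite lerDl mulr_ge0 // ltW // weight_gt0.
Qed.

(** The terms beyond m0 add up to at most a geometric tail. *)
Lemma score_tail g j m0 m : admissible g j ->
  score m j <= score m0 j + (1 / 2) ^+ m0.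
Proof.
move=> gj.
have p k : 0 <= (1 / 2 : R) ^+ k by rewrite exprn_ge0 //; lra.
have term k : weight k * (j k)%:R <= (1 / 2) ^+ k.+1.
  rewrite /weight mulrAC ler_pdivrMr ?ltr0n //; apply: ler_wpM2l; first exact: p.
  by rewrite ler_nat; have := admissible_depth k gj => /ltnW/leqW.
have [/subnK <-|/ltnW lem] := leqP m0 m; last first.
  by apply: le_trans (score_le _ lem) _; rewrite lerDl.
suff H d : score (d + m0) j <= score m0 j + (1 / 2) ^+ m0 - (1 / 2) ^+ (d + m0).
  by apply: le_trans (H _) _; rewrite lerBlDr lerDl.
elim: d => [|d IH]; first by rewrite add0n addrK.
rewrite addSn scoreS; move: IH (term (d + m0)%N); rewrite !exprS; lra.
Qed.

Lemma score_le1 g j m : admissible g j -> score m j <= 1.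
Proof.
by move=> /(score_tail 0 m) /le_trans; apply; rewrite /score big_ord0 add0r expr0.
Qed.

Lemma admissible0 g : dual_ball g -> admissible g (fun=> 0%N).
Proof. by move=> gb k. Qed.

(** Let j k be the largest number of derivations survived by f. As f does not
    survive j k + 1 of them, some neighbourhood of f contains no two points at
    distance at least mesh k that survive j k. Hence no functional close enough
    to f survives more derivations than f does, and those at distance at least
    mesh k0 from f survive fewer. *)
Lemma score_local f m0 k0 : dual_ball f -> (k0 < m0)%N ->
  exists j, admissible f j /\ exists xs : seq X, exists2 r : R, 0 < r &
    forall g j', wnear xs r f g -> admissible g j' ->
      score m0 j' <= score m0 j /\
      (mesh k0 <= O (g - f) -> score m0 j' + weight k0 <= score m0 j).
Proof.
move=> fb km.
have top k : exists jk, szlenk (mesh k) jk f /\ ~ szlenk (mesh k) jk.+1 f.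
  have ex : exists i, `[< szlenk (mesh k) i f >] by exists 0%N; exact/asboolP.
  have ub i : `[< szlenk (mesh k) i f >] -> (i <= depth k)%N.
    move=> /asboolP fi; rewrite leqNgt; apply/negP => /ltnW si.
    exact: depthP (szlenk_le si fi).
  have [i /asboolP fi imax] := ex_maxnP ex ub; exists i; split=> // fi'.
  by have := imax i.+1 (asboolT fi'); rewrite ltnn.
have [j jP] := choice top.
exists j; split=> [k|]; first by have [] := jP k.
have nd k : exists p : seq X * R, 0 < p.2 /\ forall g g', szlenk (mesh k) (j k) g ->
    szlenk (mesh k) (j k) g' -> wnear p.1 p.2 f g -> wnear p.1 p.2 f g' ->
    O (g - g') < mesh k.
  have [_ /not_derived [xs [r r0 h]]] := jP k; by exists (xs, r).
have [p pP] := choice nd.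
have h2 k : 0 < (p k).2 / 2 by rewrite divr_gt0 //; have [] := pP k.
have [xs [r r0 near]] := wnear_join f (fun k => (p k).1) m0 h2.
exists xs, r => // g j' fg gj'.
have jj k : (k < m0)%N -> (j' k <= j k)%N.
  move=> km0; rewrite leqNgt; apply/negP => lt.
  have [a [b [Ka Kb ga gb ab]]] := szlenk_le lt (gj' k) (p k).1 _ (h2 k).
  have [_ h] := pP k; have := h a b Ka Kb.
  have gk := near k g km0 fg.
  have n1 := wnear_tri gk ga; have n2 := wnear_tri gk gb.
  have E : (p k).2 / 2 + (p k).2 / 2 = (p k).2 by lra.
  by rewrite E in n1 n2; move=> /(_ n1 n2); rewrite ltNge ab.
split=> [|far].
  by apply: ler_sum => k _; rewrite ler_pM2l ?weight_gt0 // ler_nat jj.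
have lt : (j' k0 < j k0)%N.
  rewrite ltnNge; apply/negP => le.
  have [pk0 h] := pP k0.
  have n1 : wnear (p k0).1 (p k0).2 f g.
    by apply: wnear_le (near k0 g km fg) => //; rewrite ler_pdivrMr // ler_peMr ?ltW //; lra.
  have := h g f (szlenk_le le (gj' k0)) (jP k0).1 n1 (@wnear_refl (p k0).1 (p k0).2 f pk0).
  by rewrite ltNge far.
rewrite /score (bigD1 (Ordinal km)) //= [leRHS](bigD1 (Ordinal km)) //= addrAC.
apply: lerD.
  rewrite -[X in _ + X]mulr1 -mulrDr ler_pM2l ?weight_gt0 // -(natrD _ _ 1) ler_nat.
  by rewrite addn1.
by apply: ler_sum => k _; rewrite ler_pM2l ?weight_gt0 // ler_nat jj.
Qed.

(** The functionals g / (2 - score) generate the new dual ball: a functional that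
    survives more derivations counts for more. *)
Definition score_norm (x : X) : R :=
  sup [set r | exists g j m, admissible g j /\ r = `|g x| / (2 - score m j)].

Local Notation N := score_norm.

Lemma score_norm_den g j m : admissible g j -> 1 <= 2 - score m j.
Proof. by move=> /(score_le1 m); lra. Qed.

Lemma score_norm_has_sup x :
  has_sup [set r | exists g j m, admissible g j /\ r = `|g x| / (2 - score m j)].
Proof.
split.
  exists (`|(0 : dual X) x| / (2 - score 0 (fun=> 0%N))), 0, (fun=> 0%N), 0%N.
  by split=> //; apply: admissible0 => y; rewrite dual0E normr0.
exists `|x| => _ [g [j [m [gj ->]]]].
have d1 := score_norm_den m gj; have := admissible_ball gj x => gx.
rewrite ler_pdivrMr; last by apply: lt_le_trans d1.
by apply: le_trans gx _; rewrite ler_peMr.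
Qed.

Lemma score_norm_ub x g j m : admissible g j -> `|g x| <= N x * (2 - score m j).
Proof.
move=> gj; have d1 := score_norm_den m gj.
rewrite -ler_pdivrMr; last by apply: lt_le_trans d1.
by apply: sup_upper_bound (score_norm_has_sup x) _ _; exists g, j, m.
Qed.

Lemma score_norm_le x (c : R) :
  (forall g j m, admissible g j -> `|g x| <= c * (2 - score m j)) -> N x <= c.
Proof.
move=> h; have [ne _] := score_norm_has_sup x.
apply: ge_sup => // _ [g [j [m [gj ->]]]]; have d1 := score_norm_den m gj.
by rewrite ler_pdivrMr; [exact: h|apply: lt_le_trans d1].
Qed.

Lemma score_norm_upper x : N x <= `|x|.
Proof.
apply: score_norm_le => g j m gj; have d1 := score_norm_den m gj.
by apply: le_trans (admissible_ball gj x) _; rewrite ler_peMr.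
Qed.

Lemma score_norm_lower x : `|x| <= 2 * N x.
Proof.
have [f [fb <-]] := hahn_banach x.
apply: le_trans (ler_norm _) _.
have := score_norm_ub x 0 (admissible0 fb).
by rewrite /score big_ord0 subr0 mulrC.
Qed.

Lemma score_norm_equivalent : equivalent_norm N.
Proof.
have half (a : R) x : N (a *: x) <= `|a| * N x.
  apply: score_norm_le => g j m gj.
  by rewrite dualZ normrM -mulrA ler_wpM2l // score_norm_ub.
split.
- move=> x y; apply: score_norm_le => g j m gj.
  by rewrite dualD mulrDl; apply: le_trans (ler_normD _ _) _; rewrite lerD ?score_norm_ub.
- move=> a x; apply/eqP; rewrite eq_le half /=.
  have [->|a0] := eqVneq a 0.
    by rewrite normr0 mul0r; have := score_norm_lower (0 *: x); have := normr_ge0 (0 *: x); lra.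
  rewrite -ler_pdivlMl ?normr_gt0 // -normfV; apply: le_trans (half _ _).
  by rewrite scalerA mulVf // scale1r.
- move=> x Nx; apply/eqP; rewrite -normr_le0; apply: le_trans (score_norm_lower x) _.
  by rewrite Nx mulr0.
- exists (1 / 2), 1; split=> [||x]; [lra|lra|split].
    by have := score_norm_lower x; lra.
  by rewrite mul1r score_norm_upper.
Qed.

(** Asymptotic uniform smoothness. By compactness, finitely many f with the
    neighbourhoods of score_local cover the ball. If g is near such an f, then
    g (x + t y) is at most f x + t (g - f) y up to mu. When g - f is small in norm
    the second term is small; when it is not, the score of g has dropped by
    weight k0, which outweighs 8 t. *)
Lemma score_norm_smooth x k0 (mu t : R) : N x <= 1 -> 0 < mu -> 0 <= t -> t <= 1 ->
  8 * t <= weight k0 ->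
  exists fs : seq (dual X), forall y, `|y| <= 4 ->
    (forall f, f \in fs -> `|f y| <= mu) ->
    N (x + t *: y) <= 1 + 4 * mu + 4 * t * mesh k0.
Proof.
move=> Nx mu0 t0 t1 tw.
have [m0 [km tail]] : exists m0, (k0 < m0)%N /\ (1 / 2 : R) ^+ m0 <= mu.
  have /cvgrPdist_lt /(_ mu mu0) : (1 / 2 : R) ^+ n @[n --> \oo] --> (0 : R).
    by apply: cvg_expr; rewrite gtr0_norm; lra.
  move=> [n _ nP]; exists (maxn n k0.+1); rewrite leq_max ltnSn orbT; split=> //.
  have := nP (maxn n k0.+1) (leq_maxl _ _).
  by rewrite /= sub0r normrN => /ltW; apply: le_trans; exact: ler_norm.
have loc f : exists p : (nat -> nat) * (seq X * R), 0 < p.2.2 /\ (dual_ball f ->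
    admissible f p.1 /\ forall g j', wnear p.2.1 p.2.2 f g -> admissible g j' ->
      score m0 j' <= score m0 p.1 /\
      (mesh k0 <= O (g - f) -> score m0 j' + weight k0 <= score m0 p.1)).
  have [fb|nfb] := pselect (dual_ball f); last first.
    by exists (fun=> 0%N, ([::], 1)); split=> // /nfb.
  by have [j [fj [xs [r r0 h]]]] := score_local fb km; exists (j, (xs, r)).
have [p pP] := choice loc.
have e0 f : 0 < Num.min (p f).2.2 mu by rewrite lt_min mu0 (pP f).1.
have [fs [fsb cov]] := wstar_ball_cover 1 (fun f => x :: (p f).2.1) e0.
exists fs => y y4 fy.
apply: score_norm_le => g j m gj.
have [|f ffs fg] := cov g; first by move=> z; rewrite mul1r; exact: admissible_ball gj z.
have fb : dual_ball f by move=> z; have := fsb f ffs z; rewrite mul1r.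
have [_ /(_ fb) [fj locf]] := pP f; set jf := (p f).1 in fj locf.
have [le gain] : score m0 j <= score m0 jf /\
    (mesh k0 <= O (g - f) -> score m0 j + weight k0 <= score m0 jf).
  apply: locf gj; apply: wnear_le fg; last by rewrite ge_min lexx.
  by move=> z zp; rewrite inE zp orbT.
have gx : `|g x - f x| <= mu.
  have /ltW/le_trans := fg x (mem_head _ _); apply.
  by rewrite ge_min lexx orbT.
have fx : `|f x| <= 2 - score m0 jf.
  apply: le_trans (score_norm_ub x m0 fj) _.
  by rewrite ler_piMl //; have := score_norm_den m0 fj; lra.
have fyf := fy f ffs.
have gfy : `|(g - f) y| <= O (g - f) * 4.
  apply: le_trans (dual_norm_ub (equivalent_norm_id X) _ _) _.
  by rewrite ler_wpM2l //; exact: dual_norm_ge0 (equivalent_norm_id X) _.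
have O2 : O (g - f) <= 2.
  apply: (dual_norm_le (equivalent_norm_id X)) => // z.
  rewrite dualBE; apply: le_trans (ler_normB _ _) _.
  by have := admissible_ball gj z; have := fb z; lra.
have sg := score_tail m0 m gj.
have s1 := score_le1 m gj.
have E : g (x + t *: y) = f x + (g x - f x) + t * (f y + (g - f) y) :> R.
  rewrite dualD dualZ dualBE.
  have E (a b c d : R) : a + t * c = b + (a - b) + t * (d + (c - d)) by ring.
  exact: E.
rewrite E; apply: le_trans (ler_normD _ _) _.
apply: le_trans (lerD (ler_normD _ _) (lexx _)) _.
rewrite normrM (ger0_norm t0).
have h3 : t * `|f y + (g - f) y| <= t * mu + 4 * t * O (g - f).
  apply: (@le_trans _ _ (t * (mu + O (g - f) * 4))); last by move: (O _) => o; rewrite le_eqVlt; apply/orP; left; apply/eqP; ring.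
  rewrite ler_wpM2l //; apply: le_trans (ler_normD _ _) _; exact: lerD.
have tmu : t * mu <= mu by rewrite ler_piMl // ltW.
have m0' : 0 <= mesh k0 by rewrite exprn_ge0 //; lra.
suff : 4 * t * O (g - f) + (2 - score m0 jf) <= (2 - score m j) + mu + 4 * t * mesh k0.
  move: (score m j) (score m0 jf) (score m0 j) (O (g - f)) (mesh k0) s1 sg le fx h3 m0' => S Sf S0 o e.
  move: (`|f y + (g - f) y|) (`|f x|) (`|g x - f x|) gx => b c d gx s1 sg le fx h3 m0' H.
  have : 0 <= (4 * mu + 4 * t * e) * (1 - S).
    have te : 0 <= t * e by exact: mulr_ge0.
    by apply: mulr_ge0; lra.
  lra.
have [near|far] := ltP (O (g - f)) (mesh k0).
  have : 4 * t * O (g - f) <= 4 * t * mesh k0 by rewrite ler_wpM2l ?mulr_ge0 // ltW.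
  by lra.
have : 4 * t * O (g - f) <= 8 * t.
  have : 4 * t * O (g - f) <= 4 * t * 2 by rewrite ler_wpM2l ?mulr_ge0.
  by lra.
have := gain far.
have : 0 <= 4 * t * mesh k0 by rewrite !mulr_ge0.
by lra.
Qed.

(** Duality. Let h x be almost 1 and let g vanish at x and on the net given by
    almost_kernel. A point almost norming g can be moved to a point y at which h
    and the functionals of score_norm_smooth are small, and then h + tau g is
    tested at x + t y: it gains 3/4 tau t, whereas the norm of x + t y exceeds 1
    by much less. *)
Lemma score_norm_auc : auc_star (dual_norm N).
Proof.
have HN := score_norm_equivalent.
apply: auc_star_intro => tau tau0.
have [k0 k0P] : exists k0, mesh k0 <= tau / 32.
  have t32 : 0 < tau / 32 by lra.
  have /cvgrPdist_lt /(_ _ t32) : (1 / 2 : R) ^+ n @[n --> \oo] --> (0 : R).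
    by apply: cvg_expr; rewrite gtr0_norm; lra.
  move=> [n _ /(_ n (leqnn n))]; rewrite /= sub0r normrN => /ltW h.
  by exists n; apply: le_trans h; exact: ler_norm.
(* The bounds on t make tau * t at most 1 and 8 * t at most weight k0. *)
pose t := Num.min (Num.min 1 tau^-1) (weight k0 / 8).
have t0 : 0 < t.
  by rewrite !lt_min ltr01 invr_gt0 tau0 /= divr_gt0 ?weight_gt0.
have t1 : t <= 1 by rewrite !ge_min lexx.
have tt : t <= tau^-1 by rewrite !ge_min lexx orbT.
have tw : 8 * t <= weight k0.
  have : t <= weight k0 / 8 by rewrite ge_min lexx orbT.
  by lra.
pose v := tau * t; have v0 : 0 < v by rewrite mulr_gt0.
have v1 : v <= 1 by rewrite /v -ler_pdivlMl // mulr1.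
have mu0 : 0 < v / 64 by lra.
exists (v / 8) => [|h Mh]; first by lra.
have [x [Nx hx]] := @dual_norm_gt _ _ _ HN h (1 - v / 64) ltac:(rewrite Mh; lra).
have [fs smooth] := score_norm_smooth Nx mu0 (ltW t0) t1 tw.
have [F FP] := almost_kernel (h :: fs) 2 mu0.
exists ([set: dual X] `&` [set f | forall z, z \in x :: F -> f z = 0]).
split; first exact/cof_kers/cof_setT.
move=> g [_ gF] Mg.
have [z [Nz gz]] := @dual_norm_gt _ _ _ HN g (3 / 4) ltac:(rewrite Mg; lra).
have z2 : `|z| <= 2 by have := score_norm_lower z; lra.
have [|y [y4 gy hy]] := FP g _ z z2.
  by move=> w wF; apply: gF; rewrite inE wF orbT.
have Ny : N (x + t *: y) <= 1 + 4 * (v / 64) + 4 * t * mesh k0.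
  apply: smooth; first by lra.
  by move=> f ffs; apply: hy; rewrite inE ffs orbT.
have gx : g x = 0 by apply: gF; rewrite mem_head.
have hyy := hy h (mem_head _ _).
have := dual_norm_ub HN (h + tau *: g) (x + t *: y).
move=> /(le_trans (ler_norm _)).
have -> : (h + tau *: g) (x + t *: y) = h x + t * h y + v * g z :> R.
  rewrite dualDE dualZE !dualD !dualZ gx gy /v.
  have E (a b c : R) : a + t * b + tau * (0 + t * c) = a + t * b + tau * t * c by ring.
  exact: E.
have tm : 4 * t * mesh k0 <= v / 8.
  have : 4 * t * mesh k0 <= 4 * t * (tau / 32) by rewrite ler_wpM2l // mulr_ge0 // ltW.
  by rewrite /v; lra.
have vg : v * (3 / 4) <= v * g z by rewrite ler_pM2l // ltW.
have th : - (v / 64) <= t * h y.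
  have h1 : - (v / 64) <= h y by move: hyy; rewrite ler_norml => /andP[].
  have : t * (- (v / 64)) <= t * h y by rewrite ler_pM2l.
  have : t * (v / 64) <= 1 * (v / 64) by rewrite ler_wpM2r // ltW.
  by lra.
have Nxy0 := eqnorm_ge0 HN (x + t *: y).
move=> main; rewrite leNgt; apply/negP => small.
have M0 := dual_norm_ge0 HN (h + tau *: g).
move: (dual_norm N _) small M0 main => m small M0 main.
move: (N (x + t *: y)) Ny Nxy0 main => n Ny Nxy0 main.
have : m * n <= (1 + v / 8) * (1 + 4 * (v / 64) + v / 8).
  apply: ler_pM => //; first exact: ltW.
  by lra.
have : v * v <= v by exact: ler_piMl (ltW v0) v1.
move: main vg th hx; move: (v * g z) (t * h y) (h x) => A B C.
by lra.
Qed.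

End Szlenk.

(** * Trees in the dual *)

Definition upd (D : Type) (d : nat -> D) (m : nat) (v : D) : nat -> D :=
  fun i => if i == m then v else d i.

(** The condition on the m-th term may involve all earlier terms: build longer and
    longer initial segments and read off the diagonal. *)
Lemma history_choice (D : Type) (d0 : D) (good : (nat -> D) -> nat -> Prop) :
  (forall d d' m, (forall i, (i <= m)%N -> d i = d' i) -> good d m -> good d' m) ->
  (forall d m, (forall i, (i < m)%N -> good d i) -> exists v, good (upd d m v) m) ->
  exists d, forall m, good d m.
Proof.
move=> ext step.
have step' (p : nat * (nat -> D)) : exists v,
    (forall i, (i < p.1)%N -> good p.2 i) -> good (upd p.2 p.1 v) p.1.
  have [h|h] := pselect (forall i, (i < p.1)%N -> good p.2 i).
    by have [v vP] := step _ _ h; exists v.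
  by exists d0.
have [g gP] := choice step'.
pose F := fix F m := if m is m'.+1 then upd (F m') m' (g (m', F m')) else fun=> d0.
have Fstable m k i : (i < m)%N -> F (k + m)%N i = F m i.
  move=> im; elim: k => // k IH; rewrite addSn /= /upd.
  by rewrite ltn_eqF // (leq_trans im) // leq_addl.
have FP m i : (i < m)%N -> good (F m) i.
  elim: m i => // m IH i; rewrite ltnS leq_eqVlt => /orP[/eqP ->|im].
    exact: (gP (m, F m)).
  apply: ext (IH _ im) => j ji; apply/esym; apply: (Fstable m 1%N).
  exact: leq_ltn_trans im.
exists (fun i => F i.+1 i) => m; apply: ext (FP m.+1 m (ltnSn m)) => i im.
by rewrite -(subnK (im : (i < m.+1)%N)) Fstable.
Qed.

Section Unconditional.
Variables (R : realType) (X : normedModType R) (N : X -> R).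
Hypothesis HN : equivalent_norm N.
Local Notation M := (dual_norm N).

(** Multipliers in [-1, 1] are averages of signs; the entries are replaced by
    signs one at a time. *)
Lemma unconditional_multiplier (C : R) (s : seq (dual X)) (a b : nat -> R) :
  unconditional M C s -> (forall i, `|b i| <= 1) ->
  M (\sum_(i < size s) (b i * a i) *: s`_i) <= C * M (\sum_(i < size s) a i *: s`_i).
Proof.
move=> sC b1; suff H k (b' : nat -> R) : (forall i, `|b' i| <= 1) ->
    (forall i, (k <= i)%N -> b' i = 1 \/ b' i = -1) ->
    M (\sum_(i < size s) (b' i * a i) *: s`_i) <= C * M (\sum_(i < size s) a i *: s`_i).
  pose b' i := if (i < size s)%N then b i else 1.
  have E : \sum_(i < size s) (b i * a i) *: s`_i = \sum_(i < size s) (b' i * a i) *: s`_i.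
    by apply: eq_bigr => i _; rewrite /b' ltn_ord.
  rewrite E; apply: (H (size s)) => i; first by rewrite /b'; case: ifP => // _; rewrite normr1.
  by rewrite /b' ltnNge => ->; left.
elim: k b' => [|k IH] b' b'1 signs.
  have := sC a (fun i => b' i == -1); congr (_ <= _); congr (M _).
  apply: eq_bigr => i _; case: (signs i (leq0n i)) => ->; last by rewrite eqxx expr1.
  by rewrite -subr_eq0 opprK -mulr2n pnatr_eq0.
pose w (c : R) i := if i == k then c else b' i.
have wP c : `|c| = 1 -> M (\sum_(i < size s) (w c i * a i) *: s`_i) <= C * M (\sum_(i < size s) a i *: s`_i).
  move=> c1; apply: IH => i; first by rewrite /w; case: eqP => // _; rewrite c1.
  rewrite /w leq_eqVlt eq_sym; case: eqP => [_ _|_ /signs //].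
  by have := ler_norml c 1; case: (ltrgtP c 0) c1 => c0 e _; [right|left|]; move: e;
    rewrite ?(ltr0_norm c0) ?(gtr0_norm c0) ?c0 ?normr0; lra.
have E : \sum_(i < size s) (b' i * a i) *: s`_i =
    ((1 + b' k) / 2) *: \sum_(i < size s) (w 1 i * a i) *: s`_i +
    ((1 - b' k) / 2) *: \sum_(i < size s) (w (-1) i * a i) *: s`_i.
  rewrite !scaler_sumr -big_split; apply: eq_bigr => i _ /=.
  rewrite !scalerA -scalerDl; congr (_ *: _).
  by rewrite /w; case: eqP => [->|_]; field.
have bk := b'1 k; rewrite ler_norml in bk; have /andP[bk1 bk2] := bk.
rewrite E; apply: le_trans (dual_normD HN _ _) _; rewrite !(dual_normZ HN).
rewrite ger0_norm; last by lra.
rewrite (ger0_norm (_ : 0 <= (1 - b' k) / 2)); last by lra.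
set B := C * _; have w1 := wP 1 (normr1 _); have w2 := wP (-1) ltac:(by rewrite normrN normr1).
have p1 : 0 <= (1 + b' k) / 2 by lra.
have p2 : 0 <= (1 - b' k) / 2 by lra.
apply: le_trans (lerD (ler_wpM2l p1 w1) (ler_wpM2l p2 w2)) _.
by rewrite -/B le_eqVlt; apply/orP; left; apply/eqP; field.
Qed.

End Unconditional.

Section Tree.
Variables (R : realType) (X : normedModType R).
Local Notation O := (@original_dual_norm R X).
Let HO := equivalent_norm_id X.

(** One of the two distant points near fp is at distance at least e / 2 from fp;
    call it f. As f - fp is small at finitely many points, it is close to a member
    x of Y that vanishes on zs and on the net of almost_kernel, and the latter
    allows a point almost norming x to be moved to z. *)
Lemma szlenk_step (e eta theta : R) k (fp : dual X) Y (zs : seq X)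
    (xs : seq (dual X)) :
  0 < e -> 0 < eta -> 0 < theta -> theta <= e / 4 -> cof_wstar X Y ->
  szlenk e k.+1 fp ->
  exists (x : dual X) (z : X) (f : dual X),
    [/\ Y x /\ (forall z', z' \in zs -> x z' = 0),
        `|z| <= 2 /\ (forall x', x' \in xs -> `|x' z| <= eta),
        e / 8 <= x z, szlenk e k f & O (f - fp - x) <= theta].
Proof.
move=> e0 eta0 th0 the cY fpK.
have [F FP] := almost_kernel xs 1 eta0.
have cY' := cof_kers (zs ++ F) cY.
have [pts [r r0 approx]] := cof_approx HO cY' th0.
have [g [g' [gK g'K gn g'n gg']]] := fpK pts r r0.
have [f [fK fn fe]] : exists f, [/\ szlenk e k f, wnear pts r fp f & e / 2 <= O (f - fp)].
  have [h|/negP] := pselect (e / 2 <= O (g - fp)); first by exists g.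
  rewrite -ltNge => h; exists g'; split=> //.
  have := dual_normD HO (g - fp) (fp - g'); rewrite addrA subrK => tri.
  have := le_trans gg' tri; rewrite [dual_norm _ (fp - g')](dual_norm_distC HO).
  by move: h; rewrite /original_dual_norm; norm_lra.
have [x [Yx xF] xn] := approx (f - fp) fn.
have Ox : e / 8 < O x.
  have := dual_norm_tri HO (f - fp) x; move: fe xn; rewrite /original_dual_norm.
  by norm_lra.
have [z0 [z01 xz0]] := dual_norm_gt HO Ox.
have [|z [z2 xz hz]] := FP x _ z0 z01.
  by move=> z zF; apply: xF; rewrite mem_cat zF orbT.
exists x, z, f; split=> //.
- by split=> // z' zz; apply: xF; rewrite mem_cat zz.
- by rewrite xz ltW.
Qed.

Variables (e C : R) (n : nat) (f0 : dual X).
Hypotheses (e0 : 0 < e) (n0 : (0 < n)%N) (f0K : szlenk e n f0).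
Hypothesis game : asymptotic_game O (unconditional O C) n [::].

Definition normalize (x : dual X) : dual X := (O x)^-1 *: x.
Definition parents (m : nat) : seq nat := if m is 0 then [::] else anc (logn 2 m).

Lemma anc_parents m : anc m = rcons (parents m) m.
Proof. by case: m => // m; exact: anc_rcons. Qed.

Lemma parents_lt m a : a \in parents m -> (a < m)%N.
Proof.
case: m => // m /mem_anc_leq /leq_ltn_trans; apply; exact: parent_lt.
Qed.

(* The errors theta along a branch add up to at most 1, and eta m bounds the m
   earlier vectors, which together contribute at most e / 16. *)
Let theta := Num.min (e / 4) n%:R^-1.
Let eta m := e / 16 / m.+1%:R.

Let vec (d : nat -> dual X * X * dual X) i := (d i).1.1.
Let pnt (d : nat -> dual X * X * dual X) i := (d i).1.2.
Let reached (d : nat -> dual X * X * dual X) i := (d i).2.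

(** The vector of a node vanishes at the points of all earlier nodes, and its own
    point is almost annihilated by their vectors. Along the branch of the node the
    normalized vectors follow the asymptotic game, and their sum leads, up to the
    errors theta, from f0 to a member of the next Szlenk derivation. *)
Definition node_good (d : nat -> dual X * X * dual X) (m : nat) : Prop :=
  (size (anc m) <= n)%N ->
  [/\ forall i, (i < m)%N -> vec d m (pnt d i) = 0,
      `|pnt d m| <= 2 /\ (forall i, (i < m)%N -> `|vec d i (pnt d m)| <= eta m),
      e / 8 <= vec d m (pnt d m),
      asymptotic_game O (unconditional O C) (n - size (anc m))
        [seq normalize (vec d a) | a <- anc m]
    & szlenk e (n - size (anc m)) (reached d m) /\
      O (reached d m - f0 - \sum_(a <- anc m) vec d a) <= (size (anc m))%:R * theta].

Lemma node_good_ext d d' m : (forall i, (i <= m)%N -> d i = d' i) ->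
  node_good d m -> node_good d' m.
Proof.
move=> dd' good /good [g1 [g2 g2'] g3 g4 [g5 g6]].
have vE i : (i <= m)%N -> vec d' i = vec d i by rewrite /vec => /dd' ->.
have pE i : (i <= m)%N -> pnt d' i = pnt d i by rewrite /pnt => /dd' ->.
have fE : reached d' m = reached d m by rewrite /reached dd'.
have sE : \sum_(a <- anc m) vec d' a = \sum_(a <- anc m) vec d a.
  by apply: eq_big_seq => a /mem_anc_leq; exact: vE.
have mE : [seq normalize (vec d' a) | a <- anc m] = [seq normalize (vec d a) | a <- anc m].
  by apply/eq_in_map => a /mem_anc_leq /vE ->.
rewrite /node_good fE sE mE !vE // !pE //; split=> //.
- by move=> i im; rewrite pE ?g1 // ltnW.
- by split=> // i im; rewrite vE ?g2' // ltnW.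
Qed.

Lemma theta_gt0 : 0 < theta.
Proof. by rewrite lt_min divr_gt0 //= invr_gt0 ltr0n. Qed.

Lemma node_good_step d m : (forall i, (i < m)%N -> node_good d i) ->
  exists v, node_good (upd d m v) m.
Proof.
move=> good.
have [sm|sm] := leqP (size (anc m)) n; last first.
  by exists (0, 0, 0); rewrite /node_good leqNgt sm.
have sp : (size (anc m) = (size (parents m)).+1)%N by rewrite anc_parents size_rcons.
have [k kE] : exists k, (n - size (parents m) = k.+1)%N by exists (n - size (anc m))%N; lia.
have km : (n - size (anc m) = k)%N by lia.
have [fp [gm [fpK fpn]]] : exists fp,
    asymptotic_game O (unconditional O C) k.+1 [seq normalize (vec d a) | a <- parents m] /\
    (szlenk e k.+1 fp /\
     O (fp - f0 - \sum_(a <- parents m) vec d a) <= (size (parents m))%:R * theta).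
  rewrite -kE; case: m good sm {sp kE km} => [|m] good sm.
    exists f0; rewrite subn0; split=> //; split=> //.
    by rewrite big_nil subr0 subrr /original_dual_norm (dual_norm0 HO) mul0r.
  have pm := parent_lt (ltn0Sn m).
  have [] := good _ pm; last by move=> _ _ _ gm [gK gn]; exists (reached d (logn 2 m.+1)).
  by apply: leq_trans sm; rewrite [anc m.+1]anc_parents size_rcons leqnSn.
have [Y [cY gY]] := gm.
have eta0 : 0 < eta m by rewrite !divr_gt0.
have the : theta <= e / 4 by rewrite ge_min lexx.
have [x [z [f [[Yx xz0] [z2 zx] xz fK fx]]]] := szlenk_step
  [seq pnt d i | i <- iota 0 m] [seq vec d i | i <- iota 0 m] e0 eta0 theta_gt0 the cY fpK.
exists (x, z, f); set d' := upd _ _ _.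
have vm : vec d' m = x by rewrite /vec /d' /upd eqxx.
have pm : pnt d' m = z by rewrite /pnt /d' /upd eqxx.
have fm : reached d' m = f by rewrite /reached /d' /upd eqxx.
have vE i : (i < m)%N -> vec d' i = vec d i by move=> im; rewrite /vec /d' /upd ltn_eqF.
have pE i : (i < m)%N -> pnt d' i = pnt d i by move=> im; rewrite /pnt /d' /upd ltn_eqF.
move=> _; rewrite vm pm fm km; split=> //.
- by move=> i im; rewrite pE // xz0 //; apply: map_f; rewrite mem_iota.
- by split=> // i im; rewrite vE // zx //; apply: map_f; rewrite mem_iota.
- rewrite anc_parents map_rcons vm.
  have -> : [seq normalize (vec d' a) | a <- parents m] = [seq normalize (vec d a) | a <- parents m].
    by apply/eq_in_map => a /parents_lt /vE ->.
  apply: gY; split.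
    by have [[Y0 Ylin] _ _] := cY; have := Ylin (O x)^-1 _ _ Yx Y0; rewrite addr0.
  apply: (dual_norm_normalize HO); apply/eqP => x0.
  by move: xz; rewrite x0 dual0E; have := divr_gt0 e0 (ltr0n R 8); lra.
- split=> //.
  rewrite anc_parents -cats1 big_cat big_seq1 vm /=.
  have -> : \sum_(a <- parents m) vec d' a = \sum_(a <- parents m) vec d a.
    by apply: eq_big_seq => a /parents_lt /vE.
  rewrite size_cat addn1 -natr1 mulrDl mul1r.
  set S := \sum_(_ <- _) _ in fpn *.
  have -> : f - f0 - (S + x) = (fp - f0 - S) + (f - fp - x).
    rewrite opprD [RHS]addrC -!addrA [X in - fp + X]addrCA addKr.
    by rewrite [X in _ = _ + X]addrC -!addrA.
  by apply: le_trans (dual_normD HO _ _) _; exact: lerD.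
Qed.
(** Upper estimate: on a full branch the sum of the vectors is close to a difference
    of two members of the ball, and unconditionality lets the coefficients vary.
    Lower estimate: evaluate at the point of the node k with the largest
    coefficient; the later vectors vanish there and the earlier ones contribute
    at most half of the main term. *)
Lemma dual_tree : exists x : nat -> dual X,
  (forall l (b : nat -> R), (size (anc l) <= n)%N -> (forall a, `|b a| <= 1) ->
     O (\sum_(a <- anc l) b a *: x a) <= `|C| * 3) /\
  (forall m (b : nat -> R), (forall a, b a != 0 -> (size (anc a) <= n)%N) ->
     forall a, (a < m)%N -> `|b a| * (e / 32) <= O (\sum_(i < m) b i *: x i)).
Proof.
have [d good] := history_choice (0, 0, 0) node_good_ext node_good_step.
exists (vec d); split.
  move=> l b sl b1.
  have [l' [sl' ll']] := anc_extend sl.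
  have [_ _ _ gm [gK gn]] := good l' (eq_leq sl').
  have full (c : nat -> R) : (forall a, `|c a| <= 1) ->
      O (\sum_(a <- anc l') c a *: vec d a) <= `|C| * 3.
    move=> c1; rewrite sl' subnn /= in gm.
    set s := [seq _ | a <- anc l'] in gm.
    have sE : size s = size (anc l') by rewrite size_map.
    have := unconditional_multiplier HO (fun i => O (vec d (nth 0%N (anc l') i))) gm (fun i => c1 (nth 0%N (anc l') i)).
    have term (a : nat) (r : R) : (r * O (vec d a)) *: normalize (vec d a) = r *: vec d a.
      have [v0|v0] := eqVneq (vec d a) 0; first by rewrite /normalize v0 !scaler0.
      rewrite /normalize scalerA -mulrA mulfV ?mulr1 //.
      by rewrite gt_eqF //; exact: dual_norm_gt0.
    have sum (r : nat -> R) : \sum_(i < size s) (r (nth 0%N (anc l') i) * O (vec d (nth 0%N (anc l') i))) *: s`_i =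
        \sum_(a <- anc l') r a *: vec d a.
      rewrite [RHS](big_nth 0%N) big_mkord -sE; apply: eq_bigr => i _.
      by rewrite (nth_map 0%N) ?term // -sE.
    rewrite sum; have -> : \sum_(i < size s) O (vec d (nth 0%N (anc l') i)) *: s`_i =
        \sum_(a <- anc l') vec d a.
      rewrite -(eq_bigr _ (fun a _ => scale1r (vec d a))) -sum.
      by apply: eq_bigr => i _; rewrite mul1r.
    move=> h; apply: le_trans h _.
    set S := \sum_(a <- _) _.
    have S3 : O S <= 3.
      have fl : O (reached d l') <= 1.
        apply: (dual_norm_le HO) => // y; rewrite mul1r.
        exact: (szlenk_le (leq0n _) gK).
      have f0l : O f0 <= 1.
        apply: (dual_norm_le HO) => // y; rewrite mul1r.
        exact: (szlenk_le (leq0n _) f0K).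
      have nth1 : n%:R * theta <= 1.
        have : theta <= n%:R^-1 by rewrite ge_min lexx orbT.
        have n0R : 0 < n%:R :> R by rewrite ltr0n.
        by move=> /(ler_wpM2l (ltW n0R)); rewrite mulfV // gt_eqF.
      rewrite sl' -/S in gn.
      have := dual_norm_tri HO S (reached d l' - f0); have := dual_normD HO (reached d l') (- f0).
      rewrite (dual_normN HO) (dual_norm_distC HO S).
      move: fl f0l gn; rewrite /original_dual_norm.
      move: (dual_norm _ _) (dual_norm _ _) => p q.
      move: nth1; move: (n%:R * theta) => r.
      by norm_lra.
    apply: (@le_trans _ _ (`|C| * O S)); last by rewrite ler_wpM2l.
    by rewrite ler_wpM2r ?ler_norm //; exact: dual_norm_ge0 HO S.
  have -> : \sum_(a <- anc l) b a *: vec d a =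
      \sum_(a <- anc l') (if a \in anc l then b a else 0) *: vec d a.
    rewrite [RHS](bigID (fun a => a \in anc l)) /= [X in _ = _ + X]big1 ?addr0; last first.
      by move=> a /negbTE ->; rewrite scale0r.
    rewrite [RHS](eq_bigr (fun a => b a *: vec d a)); last by move=> a ->.
    rewrite -[RHS]big_filter; apply: perm_big; apply: uniq_perm.
    - exact: anc_uniq.
    - by rewrite filter_uniq ?anc_uniq.
    - move=> a; rewrite mem_filter; case: (boolP (a \in anc l)) => //= al.
      by rewrite (mem_anc_trans al ll').
  by apply: full => a; case: ifP => // _; rewrite normr0.
move=> m b bn a am.
pose i0 := Ordinal am.
case: (@arg_maxP _ _ _ i0 xpredT (fun i : 'I_m => `|b i|) isT) => k _ kmax.
have bak : `|b a| <= `|b k| by exact: (kmax i0).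
have [bk0|bk0] := eqVneq (b k) 0.
  have -> : b a = 0 by apply/eqP; rewrite -normr_le0 (le_trans bak) // bk0 normr0.
  by rewrite normr0 mul0r; exact: dual_norm_ge0 HO _.
have [_ [z2 zx] xz _ _] := good k (bn _ bk0).
set S := \sum_(i < m) _; set z := pnt d k in z2 zx xz.
have Sz : `|S z| <= O S * 2.
  apply: le_trans (dual_norm_ub HO S z) _.
  by rewrite ler_wpM2l //; exact: dual_norm_ge0 HO S.
have SE : S z = b k * vec d k z + \sum_(i < m | i != k) b i * vec d i z :> R.
  by rewrite dual_sumE (bigD1 k).
have rest : `|\sum_(i < m | i != k) b i * vec d i z| <= `|b k| * (e / 16).
  apply: le_trans (ler_norm_sum _ _ _) _.
  apply: (@le_trans _ _ (\sum_(i < m | (i < k)%N) `|b k| * eta k)).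
    rewrite big_mkcond [leRHS]big_mkcond /=; apply: ler_sum => i _.
    case: (ltngtP i k) => [ik|ki|ik].
    - rewrite -val_eqE /= ltn_eqF // normrM; apply: ler_pM => //; first exact: kmax.
      exact: zx.
    - rewrite -val_eqE /= gtn_eqF //.
      have [->|bi0] := eqVneq (b i) 0; first by rewrite mul0r normr0.
      have [g1 _ _ _ _] := good i (bn _ bi0).
      by rewrite g1 // mulr0 normr0.
    - by rewrite -val_eqE /= ik eqxx.
  rewrite -(big_ord_widen m (fun=> `|b k| * eta k)); last by rewrite ltnW.
  rewrite sumr_const card_ord -mulrnAr ler_wpM2l // -[eta k *+ k]mulr_natr.
  rewrite /eta mulrAC ler_pdivrMr ?ltr0n //; apply: ler_wpM2l.
    by rewrite divr_ge0 // ltW.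
  by rewrite ler_nat leqnSn.
have main : `|b k| * (e / 8) <= `|S z| + `|b k| * (e / 16).
  have h1 : `|b k| * (e / 8) <= `|b k * vec d k z|.
    rewrite normrM ler_wpM2l //; apply: le_trans xz _; exact: ler_norm.
  have E (u v w : R) : u = v + w -> v = u - w by move=> ->; rewrite addrK.
  apply: le_trans h1 _; rewrite (E _ _ _ SE).
  by apply: le_trans (ler_normB _ _) _; rewrite lerD2l.
have h2 : `|b a| * (e / 32) <= `|b k| * (e / 32) by rewrite ler_wpM2r // divr_ge0 // ltW.
apply: le_trans h2 _; move: Sz main; rewrite /original_dual_norm.
move: (`|S z|) (`|b k|) => u v; norm_lra.
Qed.

End Tree.

(** * Embedding the bundle graphs *)

Section Embedding.
Variables (R : realType) (X : normedModType R).
Local Notation O := (@original_dual_norm R X).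
Let HO := equivalent_norm_id X.

Lemma ndistE (a b : nat) : (ndist a b)%:R = `|a%:R - b%:R| :> R.
Proof.
rewrite /ndist; case: (leqP a b) => [ab|/ltnW ba].
  have /eqP -> : (a - b == 0)%N by rewrite subn_eq0.
  by rewrite add0n natrB // distrC ger0_norm // subr_ge0 ler_nat.
have /eqP -> : (b - a == 0)%N by rewrite subn_eq0.
by rewrite addn0 natrB // ger0_norm // subr_ge0 ler_nat.
Qed.

(** The vertex v goes to the combination of the vectors of the tree with
    coefficients c v: the height at the root and the code below. The difference
    of two neighbours lives on one branch, which gives the upper estimate along
    walks; the coordinate that detects the distance gives the lower one. *)
Lemma codable_embeds (e C : R) (K : tb_graph) h : 0 < e ->
  (forall n, (0 < n)%N -> exists f, szlenk e n (f : dual X)) ->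
  (forall n, (0 < n)%N -> asymptotic_game O (unconditional O C) n [::]) ->
  codable K h -> exists f : vertex K -> dual X, forall u v,
    (e / 128) * (graph_dist u v)%:R <= O (f u - f v) /\
    O (f u - f v) <= `|C| * 3 * (graph_dist u v)%:R.
Proof.
move=> e0 sz uas [N [ht [phi [gK cb ct cbel cfin carc cwalk]]]].
have [f0 f0K] := sz N.+1 isT.
have [x [upper lower]] := dual_tree e0 (ltn0Sn N) f0K (uas _ (ltn0Sn N)).
pose c v a : R := (if a == 0 then ht v else phi 0 v a)%N%:R.
have phi0 v : phi 0%N v 0%N = 0%N.
  by case: (phi 0%N v 0%N =P 0%N) => [//|/cbel []].
have csize v a : c v a != 0 -> (size (anc a) <= N.+1)%N.
  rewrite /c; case: (a =P 0%N) => [->|_]; first by rewrite anc0.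
  by rewrite pnatr_eq0 => /eqP /cbel [_ _]; rewrite anc0.
have [B BP] := choice (cfin 0%N).
have cB v a : (maxn 1 (B v) <= a)%N -> c v a = 0.
  rewrite geq_max => /andP[a0 Ba]; rewrite /c; case: eqP a0 => [->//|_ _].
  by rewrite BP.
pose f v := \sum_(a < maxn 1 (B v)) c v a *: x a.
have fE v m : (maxn 1 (B v) <= m)%N -> f v = \sum_(a < m) c v a *: x a.
  move=> vm; rewrite /f (big_ord_widen m (fun a => c v a *: x a) vm) big_mkcond /=.
  apply: eq_bigr => a _; case: ifP => // /negbT; rewrite -leqNgt => /cB ->.
  by rewrite scale0r.
have fB u v m : (maxn (maxn 1 (B u)) (maxn 1 (B v)) <= m)%N ->
    f u - f v = \sum_(a < m) (c u a - c v a) *: x a.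
  rewrite geq_max => /andP[um vm]; rewrite (fE u m) // (fE v m) // -sumrB.
  by apply: eq_bigr => a _; rewrite scalerBl.
have cdist u v a : exists a', `|c u a' - c v a'| = (ndist (phi 0%N u a) (phi 0%N v a))%:R.
  exists (if (a == 0)%N then maxn (maxn 1 (B u)) (maxn 1 (B v)) else a).
  case: eqP => [->|/eqP a0].
    by rewrite !phi0 /ndist !cB ?subrr ?normr0 // ?leq_maxl // leq_maxr.
  by rewrite ndistE /c (negbTE a0).
have low u v a : `|c u a - c v a| * (e / 32) <= O (f u - f v).
  rewrite (fB u v (maxn a.+1 (maxn (maxn 1 (B u)) (maxn 1 (B v))))) ?leq_maxr //.
  apply: (lower _ (fun a => c u a - c v a)); last by rewrite leq_maxl.
  move=> i; have [cu0|/csize //] := eqVneq (c u i) 0.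
  by rewrite cu0 sub0r oppr_eq0 => /csize.
have arc u v : tb_arc u v -> O (f u - f v) <= `|C| * 3.
  move=> uv; have [d1 [l [sl rl ln]]] := carc 0%N _ _ uv.
  rewrite anc0 add1n in sl.
  have huv : ht v = (ht u).+1 by have [_ _ ha _] := gK; exact: ha.
  pose m := maxn l.+1 (maxn (maxn 1 (B u)) (maxn 1 (B v))).
  rewrite (fB u v m) ?leq_maxr //.
  have out a : a \notin anc l -> c u a - c v a = 0.
    move=> al; rewrite /c; case: eqP al => [->|_ al]; first by rewrite rl.
    by have [-> ->] := ln a al; rewrite subrr.
  have -> : \sum_(a < m) (c u a - c v a) *: x a = \sum_(a <- anc l) (c u a - c v a) *: x a.
    rewrite -(big_mkord xpredT (fun a => (c u a - c v a) *: x a)).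
    rewrite (bigID (fun a => a \in anc l)) /= [X in _ + X = _]big1 ?addr0; last first.
      by move=> a /out ->; rewrite scale0r.
    rewrite -big_filter; apply: perm_big; apply: uniq_perm.
    - by rewrite filter_uniq // iota_uniq.
    - exact: anc_uniq.
    - move=> a; rewrite mem_filter mem_index_iota /=; case: (boolP (a \in anc l)) => //= al.
      by rewrite (leq_ltn_trans (mem_anc_leq al)) // leq_maxl.
  apply: upper => // a; rewrite /c; case: eqP => [_|_].
    by rewrite -ndistE huv (ler_nat _ _ 1) /ndist; lia.
  by rewrite -ndistE (ler_nat _ _ 1).
have walk_up k u v : walk k u v -> O (f u - f v) <= `|C| * 3 * k%:R.
  elim: k u => [u ->|k IH u [w [uw /IH wv]]].
    by rewrite subrr mulr0 /original_dual_norm (dual_norm0 HO).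
  have uw' : O (f u - f w) <= `|C| * 3.
    case: uw => /arc //; by rewrite /original_dual_norm (dual_norm_distC HO).
  have -> : f u - f v = (f u - f w) + (f w - f v) by rewrite addrA subrK.
  apply: le_trans (dual_normD HO _ _) _.
  by rewrite -[k.+1%:R]natr1 mulrDr mulr1 [leRHS]addrC; exact: lerD.
exists f => u v.
have [k [wk hk]] := cwalk 0%N u v; have [wd dk] := graph_distP wk.
split; last exact: walk_up.
have [a ka] : exists a, (k%:R : R) <= 4 * `|c u a - c v a|.
  case: hk => [hk|[a hk]].
    by exists 0%N; rewrite /c eqxx -ndistE -(natrM _ 4) ler_nat.
  by have [a' E] := cdist u v a; exists a'; rewrite E -(natrM _ 4) ler_nat.
apply: le_trans (low u v a).
have dk' : ((graph_dist u v)%:R : R) <= k%:R by rewrite ler_nat.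
move: (`|c u a - c v a|) ka => t ka.
move: dk' ka; move: (graph_dist u v)%:R (k%:R : R) => D k' Dk kt.
have : 0 <= e * (4 * t - D) by apply: mulr_ge0; [exact: ltW|lra].
lra.
Qed.

Lemma szlenk_embeds (e C : R) (G : tb_graph) : 0 < e ->
  (forall n, exists f, szlenk e n (f : dual X)) ->
  (forall n, (0 < n)%N -> asymptotic_game O (unconditional O C) n [::]) ->
  nontrivial_bundle_graph G -> equi_lipschitz_embeds X (slash_pow G).
Proof.
move=> e0 sz uas [s [_ sG]].
have emb n : exists f : vertex (slash_pow G n) -> dual X, forall u v,
    (e / 128) * (graph_dist u v)%:R <= O (f u - f v) /\
    O (f u - f v) <= `|C| * 3 * (graph_dist u v)%:R.
  have cn : codable (slash_pow G n) (fheight s ^ n.-1.+1).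
    by case: n => [|n]; [exact: (codable_slash_pow 0)|exact: codable_slash_pow].
  exact: codable_embeds e0 (fun n _ => sz n) uas cn.
exists (Num.max 1 (`|C| * 3 / (e / 128))), (fun n => projT1 (cid (emb n))), (fun=> e / 128).
split; first by rewrite le_max lexx.
move=> n _; split=> [|u v]; first by rewrite divr_gt0.
case: cid => f /= fP; have [lo hi] := fP u v; split=> //.
apply: le_trans hi _; rewrite ler_wpM2r //.
have e1 : 0 < e / 128 by rewrite divr_gt0.
rewrite [leRHS]mulrC -ler_pdivrMr //; by rewrite le_max lexx orbT.
Qed.

End Embedding.

Theorem theoremB (R : realType) (X : completeNormedModType R) (G : tb_graph)
    (X_separable : separable X)
    (X_uas : wstar_unconditional_asymptotic_structure X)
    (G_bundle : nontrivial_bundle_graph G) :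
  (exists N : X -> R, equivalent_norm N /\ auc_star (dual_norm N))
  <->
  ~ equi_lipschitz_embeds X (slash_pow G).
Proof.
split=> [[N [HN auc]]|nemb]; first exact: auc_star_not_embeds HN auc G_bundle.
have [C [_ uas]] := X_uas.
have fin k : exists n, forall f : dual X, ~ szlenk (mesh R k) n f.
  apply: contrapT => h; apply: nemb.
  apply: (@szlenk_embeds R X (mesh R k) C) => // [|n].
    by rewrite exprn_gt0 // divr_gt0.
  apply: contrapT => hn; apply: h; exists n => f fK; apply: hn.
  by exists f.
have [depth depthP] := choice fin.
exists (score_norm (X := X) depth); split; first exact: score_norm_equivalent.
exact: score_norm_auc.
Qed.
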